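(* For each $N\ge1$ let $\theta_i(\mathbf x,\mathbf p)$ denote the $\boldsymbol\theta$-components of $\omega^{-1}(\mathbf x,\mathbf p)$ and $$H_\psi(\mathbf x,\mathbf p)=\frac12\sum_{i=1}^N\theta_i(\mathbf x,\mathbf p)^2=\sum_{i=1}^N\frac{p_i^2}{2}+V_\psi(\mathbf x,\mathbf p).$$ Then $H_\psi\in C^1(\mathbb R^{2N})$ and the trajectories $t\mapsto\omega(\mathbf y+t\boldsymbol\theta,\boldsymbol\theta)$ are exactly the solutions of $\dot x_i=\{x_i,H_\psi\}$, $\dot p_i=\{p_i,H_\psi\}$. The functions $Q_a(\mathbf x,\mathbf p)=\sum_i\theta_i(\mathbf x,\mathbf p)^a$, $a=1,\dots,N$, are $C^1$, functionally independent, pairwise Poisson-commuting, and $H_\psi=\frac12 Q_2$; hence $H_\psi$ is Liouville integrable. Moreover the sequence $(H_\psi)_{N\ge1}$ is Liouville integrable with finite-range interaction of range $\epsilon$ with respect to the dispersion relations $E_a(p)=p^a$: writing $Q_a=\sum_ip_i^a+V_a$, each quasi-potential $V_a$ has finite range $\epsilon$ uniformly in $N$.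
   Context: Fix $\epsilon>0$ and $\psi\in C^2(\mathbb R^2)$ such that for all $(x,\theta)\in\mathbb R^2$: $\psi_{x\theta}(x,\theta)\ge 0$, $\psi(-x,-\theta)=\psi(x,\theta)$, and $\psi_x(x,\theta)=0$ whenever $|x|\ge\epsilon$. Phase space $\mathbb R^{2N}$ with canonical Poisson bracket $\{x_i,p_j\}=\delta_{ij}$, $\{x_i,x_j\}=\{p_i,p_j\}=0$. The map $\omega:(\mathbf y,\boldsymbol\theta)\mapsto(\mathbf x,\mathbf p)$ is defined by solving $y_i=x_i+\sum_{j\ne i}\psi_\theta(x_i-x_j,\theta_i-\theta_j)$ for $\mathbf x$ and then setting $p_i=\theta_i+\sum_{j\ne i}\psi_x(x_i-x_j,\theta_i-\theta_j)$; it is a $C^1$ diffeomorphism of $\mathbb R^{2N}$. Cluster partition: for $\mathbf x\in\mathbb R^N$, $P_\epsilon(\mathbf x)$ is the finest partition of $\{1,\dots,N\}$ such that $|x_i-x_j|>\epsilon$ whenever $i,j$ lie in different blocks (the blocks are the connected components of the graph joining $i,j$ when $|x_i-x_j|\le\epsilon$). For a block $I$, $\mathbf x_I=(x_i)_{i\in I}$ in increasing order of indices. Finite range: a function $V\in C^1(\mathbb R^{2N})$ has finite range $\epsilon$ if for every $n\in\{1,\dots,N\}$ there is $V^{(n)}\in C^1(\mathbb R^{2n})$ with $V^{(1)}\equiv0$ and $V(\mathbf x,\mathbf p)=\sum_{I\in P_\epsilon(\mathbf x)}V^{(|I|)}(\mathbf x_I,\mathbf p_I)$ for all $(\mathbf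 x,\mathbf p)$; ''uniformly in $N$'' means the functions $V^{(n)}$ can be chosen independent of $N$. A sequence of Hamiltonians $(H_N)_{N\ge1}$ is Liouville integrable with finite-range interaction if each $H_N$ is Liouville integrable and there are $E_a\in C^1(\mathbb R)$, independent of $N$, with $\sum_iE_a(p_i)$, $a=1..N$, functionally independent, such that the conserved quantities have the form $Q_a=\sum_iE_a(p_i)+V_a$ with all $V_a$ of finite range $\epsilon$ uniformly in $N$. *)

(* Defs.v *)
From HB Require Import structures.
From mathcomp Require Import all_boot all_order all_algebra.
From mathcomp Require Import all_classical all_reals all_analysis.
From Stdlib Require Import ClassicalEpsilon.

Set Implicit Arguments.
Unset Strict Implicit.
Unset Printing Implicit Defensive.

Import Order.TTheory GRing.Theory Num.Theory.
Import numFieldNormedType.Exports.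
Local Open Scope classical_set_scope.
Local Open Scope ring_scope.

Section Defs.
Variable R : realType.

Definition pd (n : nat) (f : 'rV[R]_n -> R) (k : 'I_n) (z : 'rV[R]_n) : R :=
  'D_(delta_mx ord0 k) f z.

Definition C1 (n : nat) (f : 'rV[R]_n -> R) : Prop :=
  (forall z k, derivable f z (delta_mx ord0 k)) /\
  (forall k, continuous (pd f k)).

Definition C2 (n : nat) (f : 'rV[R]_n -> R) : Prop :=
  C1 f /\ forall k, C1 (pd f k).

Definition C1R (f : R -> R) : Prop :=
  (forall x, derivable f x 1) /\ continuous (fun x => 'D_1 f x).

Definition i0 : 'I_2 := ord0.
Definition i1 : 'I_2 := ord_max.
Definition pt2 (a b : R) : 'rV[R]_2 := \row_(k < 2) (if k == i0 then a else b).
Definition psi2 (psi : R -> R -> R) : 'rV[R]_2 -> R :=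
  fun v => psi (v ord0 i0) (v ord0 i1).
Definition psix (psi : R -> R -> R) (a b : R) : R := pd (psi2 psi) i0 (pt2 a b).
Definition psith (psi : R -> R -> R) (a b : R) : R := pd (psi2 psi) i1 (pt2 a b).
Definition psixth (psi : R -> R -> R) (a b : R) : R :=
  pd (pd (psi2 psi) i0) i1 (pt2 a b).

Definition xs (N : nat) (z : 'rV[R]_(N + N)) (i : 'I_N) : R := z ord0 (lshift N i).
Definition ps (N : nat) (z : 'rV[R]_(N + N)) (i : 'I_N) : R := z ord0 (rshift N i).
Definition coord (n : nat) (k : 'I_n) (z : 'rV[R]_n) : R := z ord0 k.

Definition poisson (N : nat) (f g : 'rV[R]_(N + N) -> R) (z : 'rV[R]_(N + N)) : R :=
  \sum_(i < N) (pd f (lshift N i) z * pd g (rshift N i) z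
                - pd f (rshift N i) z * pd g (lshift N i) z).

Definition omega_x (N : nat) (psi : R -> R -> R) (y th : 'rV[R]_N) : 'rV[R]_N :=
  epsilon (inhabits 0) (fun x : 'rV[R]_N => forall i : 'I_N,
    y ord0 i = x ord0 i +
      \sum_(j < N | j != i) psith psi (x ord0 i - x ord0 j) (th ord0 i - th ord0 j)).

Definition omega (N : nat) (psi : R -> R -> R) (w : 'rV[R]_(N + N)) : 'rV[R]_(N + N) :=
  let y := lsubmx w in let th := rsubmx w in
  let x := omega_x psi y th in
  row_mx x (\row_(i < N) (th ord0 i +
      \sum_(j < N | j != i) psix psi (x ord0 i - x ord0 j) (th ord0 i - th ord0 j))).

Definition omega_inv (N : nat) (psi : R -> R -> R) (z : 'rV[R]_(N + N)) : 'rV[R]_(N + N) :=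
  epsilon (inhabits 0) (fun w => omega psi w = z).
Definition thetaf (N : nat) (psi : R -> R -> R) (z : 'rV[R]_(N + N)) (i : 'I_N) : R :=
  rsubmx (omega_inv psi z) ord0 i.

Definition Hpsi (N : nat) (psi : R -> R -> R) (z : 'rV[R]_(N + N)) : R :=
  2^-1 * \sum_(i < N) thetaf psi z i ^+ 2.
Definition Qpsi (N : nat) (psi : R -> R -> R) (a : nat) (z : 'rV[R]_(N + N)) : R :=
  \sum_(i < N) thetaf psi z i ^+ a.

Definition traj (N : nat) (psi : R -> R -> R) (y th : 'rV[R]_N) (t : R) : 'rV[R]_(N + N) :=
  omega psi (row_mx (y + t *: th) th).

Definition ham_solution (N : nat) (H : 'rV[R]_(N + N) -> R) (gamma : R -> 'rV[R]_(N + N)) : Prop :=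
  forall t, derivable gamma t 1 /\
    forall k : 'I_(N + N), ('D_1 gamma t) ord0 k = poisson (coord k) H (gamma t).

Definition funct_indep (n m : nat) (F : 'I_n -> 'rV[R]_m -> R) : Prop :=
  exists U : set 'rV[R]_m, open U /\ dense U /\
    forall z, U z -> row_free (\matrix_(a < n, k < m) pd (F a) k z).

Definition LI_with (N : nat) (H : 'rV[R]_(N + N) -> R) (Q : nat -> 'rV[R]_(N + N) -> R) : Prop :=
  [/\ C1 H,
      (forall a, (1 <= a <= N)%N -> C1 (Q a)),
      funct_indep (fun k : 'I_N => Q k.+1),
      (forall a b, (1 <= a <= N)%N -> (1 <= b <= N)%N -> forall z, poisson (Q a) (Q b) z = 0)
    & (forall a, (1 <= a <= N)%N -> forall z, poisson (Q a) H z = 0)].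

Definition Liouville_integrable (N : nat) (H : 'rV[R]_(N + N) -> R) : Prop :=
  exists Q, LI_with H Q.

Definition cluster_rel (N : nat) (eps : R) (x : 'I_N -> R) : rel 'I_N :=
  fun i j => `|x i - x j| <= eps.

Definition Peps (N : nat) (eps : R) (x : 'I_N -> R) : {set {set 'I_N}} :=
  equivalence_partition (connect (cluster_rel eps x)) [set: 'I_N].

(* (x_I, p_I), entries in increasing order of indices *)
Definition restrict (N : nat) (z : 'rV[R]_(N + N)) (I : {set 'I_N}) : 'rV[R]_(#|I| + #|I|) :=
  row_mx (\row_(k < #|I|) xs z (enum_val k)) (\row_(k < #|I|) ps z (enum_val k)).

Definition finite_range_unif (eps : R) (m : nat) (V : forall N, 'rV[R]_(N + N) -> R) : Prop :=
  (forall N, (1 <= N)%N -> (m <= N)%N -> C1 (V N)) /\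
  exists W : forall n, 'rV[R]_(n + n) -> R,
    (forall n, (1 <= n)%N -> C1 (W n)) /\
    (forall z, W 1%N z = 0) /\
    forall N, (1 <= N)%N -> (m <= N)%N -> forall z : 'rV[R]_(N + N),
      V N z = \sum_(I in Peps eps (xs z)) W #|I| (restrict z I).

Definition LIFR_wrt (eps : R) (H : forall N, 'rV[R]_(N + N) -> R)
    (E : nat -> R -> R) (Q : forall N, nat -> 'rV[R]_(N + N) -> R) : Prop :=
  [/\ forall N, (1 <= N)%N -> LI_with (H N) (Q N),
      forall a, (1 <= a)%N -> C1R (E a),
      forall N, (1 <= N)%N ->
        funct_indep (fun (k : 'I_N) (z : 'rV[R]_(N + N)) => \sum_(i < N) E k.+1 (ps z i))
    & forall a, (1 <= a)%N ->
        finite_range_unif eps a (fun N z => Q N a z - \sum_(i < N) E a (ps z i))].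

Definition LIFR (eps : R) (H : forall N, 'rV[R]_(N + N) -> R) : Prop :=
  exists E Q, LIFR_wrt eps H E Q.

End Defs.

Arguments Hpsi {R} N psi z.
Arguments Qpsi {R} N psi a z.

(* Main.v *)
(** Both equations defining omega have the form
    v_i + sum_(j != i) g (u_i - u_j) (v_i - v_j) = w_i with g nondecreasing in its second
    argument.  They are solved by Perron's method, and a maximum principle gives uniqueness.
    A difference quotient of the solution solves a linear system with matrix 1 + (weighted graph
    Laplacian), to which the same maximum principle applies, so the quotient converges.
    Hence theta' = X (p' - L x') along any differentiable curve, where X is the inverse of
    1 + Laplacian(psi_xth), L = Laplacian(psi_xx), and both are symmetric because psi is even.
    The brackets {theta_k, theta_l} are the entries of -X L X^T + X L^T X^T = 0, and the flow of
    H_psi is x' = X theta, p' = L X theta, along which theta is constant and y' = theta.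
    A linear relation between the gradients of the Q_a is a polynomial of degree < N vanishing at
    every theta_i, hence trivial on the dense open set where the theta_i are distinct.
    Finally, uniqueness of theta on each cluster gives the finite range. *)
Require Import Defs.
From HB Require Import structures.
From mathcomp Require Import all_boot all_order all_algebra.
From mathcomp Require Import all_classical all_reals all_analysis.
From mathcomp Require Import ring lra.
From Stdlib Require ClassicalEpsilon.

Import Order.TTheory GRing.Theory Num.Theory.
Import numFieldNormedType.Exports.
Local Open Scope classical_set_scope.
Local Open Scope ring_scope.

(** * Weighted graph Laplacians: maximum principle and stability of solutions *)

Lemma cvg_bigsum {R : realType} {S I : Type} {F : set_system S} {FF : Filter F} (r : seq I)
    (P : pred I) (f : I -> S -> R) (l : I -> R) :
  (forall i, P i -> f i s @[s --> F] --> l i) ->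
  (\sum_(i <- r | P i) f i s) @[s --> F] --> \sum_(i <- r | P i) l i.
Proof.
move=> H; elim: r => [|i r IH].
  by under eq_fun do rewrite big_nil; rewrite big_nil; exact: cvg_cst.
under eq_fun do rewrite big_cons; rewrite big_cons.
by case: ifP => // Pi; apply: cvgD => //; exact: H.
Qed.

Section MaximumPrinciple.
Context {R : realType} {N : nat}.
Implicit Types (c : 'I_N -> 'I_N -> R) (d : 'I_N -> R).

Definition oplap c d (i : 'I_N) : R := \sum_(j < N | j != i) c i j * (d i - d j).

Lemma exists_argmax d (i : 'I_N) : exists k, forall j, d j <= d k.
Proof.
by exists [arg max_(k > i) d k]%O => j; case: arg_maxP => // k _; apply.
Qed.

Lemma oplap_ge0 c d k : (forall i j, 0 <= c i j) -> (forall j, d j <= d k) ->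
  0 <= oplap c d k.
Proof.
by move=> c0 dk; apply: sumr_ge0 => j _; rewrite mulr_ge0 ?c0 // subr_ge0.
Qed.

(** At an index where [d] is largest the Laplacian term is nonnegative, so the bound holds there and
    therefore everywhere. *)
Lemma max_principle_le c d e : (forall i j, 0 <= c i j) ->
  (forall i, d i + oplap c d i <= e) -> forall i, d i <= e.
Proof.
move=> c0 H i; have [k dk] := exists_argmax d i.
by apply: le_trans (dk i) _; apply: le_trans (H k); rewrite lerDl oplap_ge0.
Qed.

Lemma oplapB c d d' i : oplap c (fun k => d k - d' k) i = oplap c d i - oplap c d' i.
Proof. by rewrite -sumrB; apply: eq_bigr => j _; ring. Qed.

Lemma oplapZ c a d i : oplap c (fun k => a * d k) i = a * oplap c d i.
Proof. by rewrite mulr_sumr; apply: eq_bigr => j _; ring. Qed.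

(** The one-sided bound is applied to [d] and to [- d]. *)
Lemma max_principle c d e : (forall i j, 0 <= c i j) ->
  (forall i, `|d i + oplap c d i| <= e) -> forall i, `|d i| <= e.
Proof.
move=> c0 H i; rewrite ler_norml; apply/andP; split; last first.
  by apply: (max_principle_le c d e c0) => k; apply: le_trans (H k); exact: ler_norm.
rewrite lerNl; have := max_principle_le c (fun k => - 1 * d k) e c0.
move=> /(_ _ i); rewrite mulN1r; apply => k; rewrite oplapZ -mulrDr mulN1r.
by apply: le_trans (H k); rewrite -normrN; exact: ler_norm.
Qed.

Lemma oplap_solution_unique c d d' : (forall i j, 0 <= c i j) ->
  (forall i, d i + oplap c d i = d' i + oplap c d' i) -> d =1 d'.
Proof.
move=> c0 H i; apply/eqP; rewrite -subr_eq0 -normr_le0.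
apply: (@max_principle c (fun k => d k - d' k) 0 c0) => {}i.
have := H i; rewrite oplapB normr_le0 => E; apply/eqP; lra.
Qed.

Lemma oplap_cvg {S : Type} {F : set_system S} {FF : Filter F} (c : S -> 'I_N -> 'I_N -> R)
    (d : S -> 'I_N -> R) c0 d0 :
  (forall i j, c s i j @[s --> F] --> c0 i j) -> (forall i, d s i @[s --> F] --> d0 i) ->
  forall i, oplap (c s) (d s) i @[s --> F] --> oplap c0 d0 i.
Proof.
move=> cc cd i; apply: cvg_bigsum => j _; apply: cvgM; first exact: cc.
by apply: cvgB; apply: cd.
Qed.

(* The difference of solutions solves the same system with a right-hand side that tends to 0. *)
Lemma oplap_solution_cvg {S : Type} {F : set_system S} {FF : Filter F}
    (c : S -> 'I_N -> 'I_N -> R) (d r : S -> 'I_N -> R) c0 d0 r0 :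
  (forall s i j, 0 <= c s i j) ->
  (forall i j, c s i j @[s --> F] --> c0 i j) -> (forall i, r s i @[s --> F] --> r0 i) ->
  (\forall s \near F, forall i, d s i + oplap (c s) (d s) i = r s i) ->
  (forall i, d0 i + oplap c0 d0 i = r0 i) ->
  forall i, d s i @[s --> F] --> d0 i.
Proof.
move=> cge cc cr Hd Hd0 i; apply/cvgrPdist_le => e e0.
have K k : (d0 k + oplap (c s) d0 k - r s k) @[s --> F] --> (0 : R).
  rewrite -[X in _ --> X](_ : d0 k + oplap c0 d0 k - r0 k = 0); last by rewrite Hd0 subrr.
  apply: cvgB => //; apply: cvgD; first exact: cvg_cst.
  by apply: oplap_cvg => // l; exact: cvg_cst.
have K' : \forall s \near F, forall k, `|d0 k + oplap (c s) d0 k - r s k| <= e.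
  apply: filter_forall => k.
  by move/cvgrPdist_le: (K k) => /(_ e e0); apply: filterS => s; rewrite distrC subr0.
apply: filterS2 K' Hd => s Ks ds.
apply: (max_principle (c s) (fun k => d0 k - d s k)) => // k.
rewrite oplapB; have -> : d0 k - d s k + (oplap (c s) d0 k - oplap (c s) (d s) k) =
  d0 k + oplap (c s) d0 k - (d s k + oplap (c s) (d s) k) by ring.
by rewrite ds.
Qed.

End MaximumPrinciple.

(** * One-variable calculus: mean values and difference quotients *)

(** Mean value theorem for endpoints in either order. Recording only that [c] is no farther from [a]
    than [b] is what later lets intermediate points converge by squeezing. *)
Lemma mvt_increment {R : realType} (f df : R -> R) :
  (forall x : R, is_derive x 1 f (df x)) ->
  forall a b, exists2 c, `|c - a| <= `|b - a| & f b - f a = df c * (b - a).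
Proof.
move=> Hf a b; have cf x : {for x, continuous f}.
  by apply: differentiable_continuous; apply/derivable1_diffP; apply: ex_derive.
have cw (x y : R) : {within `[x, y], continuous f}.
  by apply: continuous_subspaceT.
have [ab|ba] := leP a b.
  have [c /itvP cab E] := MVT_segment ab (fun x _ => Hf x) (cw a b).
  by exists c => //; rewrite !ger0_norm ?subr_ge0 ?cab // lerD2r cab.
have [c /itvP cab E] := MVT_segment (ltW ba) (fun x _ => Hf x) (cw b a).
exists c; last by rewrite -[LHS]opprB E; ring.
by rewrite !ler0_norm ?subr_le0 ?cab ?(ltW ba) // lerN2 lerD2r cab.
Qed.

Lemma is_derive_quotientP {R : realType} (f : R -> R) (t l : R) :
  is_derive t 1 f l <-> (h^-1 * (f (h + t) - f t)) @[h --> 0^'] --> l.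
Proof.
have E : (fun h : R => h^-1 *: ((f \o shift t) (h *: 1) - f t)) =
         (fun h => h^-1 * (f (h + t) - f t)).
  by apply/funext => h /=; rewrite /GRing.scale /= mulr1.
split=> [[df <-]|H].
  by move: df; rewrite /derivable /derive E.
by split; rewrite /derivable /derive E; [apply/cvg_ex; exists l | exact: cvg_lim].
Qed.

Lemma cvg_shift_dnbhs {R : realType} (f : R -> R) (t l : R) : is_derive t 1 f l ->
  f (h + t) @[h --> 0^'] --> f t.
Proof.
move=> Hf; have cf : {for t, continuous f}.
  by apply: differentiable_continuous; apply/derivable1_diffP; apply: ex_derive.
have H0 : f (h + t) @[h --> (0 : R)] --> f t.
  apply: (@cvg_comp _ _ _ (fun h : R => h + t) f _ (nbhs t)) => //.
  have : h + t @[h --> (0 : R)] --> 0 + t by apply: cvgD; [exact: cvg_id | exact: cvg_cst].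
  by rewrite add0r.
exact: (cvg_trans (cvg_app (fun h => f (h + t)) (@cvg_within _ (nbhs (0 : R)) _ _)) H0).
Qed.

(** * Nonlinear systems with a monotone kernel: uniqueness, continuity and derivative of the
    solution *)

Definition continuous2 {R : realType} (f : R -> R -> R) :=
  continuous (fun p : R * R => f p.1 p.2).

Lemma continuous2_cvg {R : realType} {S : Type} {F : set_system S} {FF : Filter F}
    (f : R -> R -> R) (a b : S -> R) a0 b0 : continuous2 f ->
  a s @[s --> F] --> a0 -> b s @[s --> F] --> b0 -> f (a s) (b s) @[s --> F] --> f a0 b0.
Proof.
move=> cf ca cb; exact: (cvg_comp2 ca cb (cf (a0, b0))).
Qed.

(** Serves to pass to the limit in the intermediate points of the mean value theorem. *)
Lemma cvg_squeeze_dist {R : realType} {S : Type} {F : set_system S} {FF : Filter F}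
    (a c : S -> R) a0 : (forall s, `|c s - a0| <= `|a s - a0|) ->
  a s @[s --> F] --> a0 -> c s @[s --> F] --> a0.
Proof.
move=> H /cvgrPdist_le ca; apply/cvgrPdist_le => e /ca.
by apply: filterS => s; rewrite -normrN opprB => le; rewrite -normrN opprB (le_trans (H s)).
Qed.

(** Common form of the equations defining [omega]: [u] is given and [v] is the unknown. With
    [u = x], [v = theta] and [g] = psi_x the value is [p]; with [u = theta], [v = x] and psi_theta,
    arguments swapped, it is [y]. *)
Definition Tmap {R : realType} {N : nat} (g : R -> R -> R) (u v : 'I_N -> R) (i : 'I_N) : R :=
  v i + \sum_(j < N | j != i) g (u i - u j) (v i - v j).

(** [ga] and [gb] are the two partial derivatives of [g]. Since [gb] is nonnegative, it can serve as
    the weights of a Laplacian obeying the maximum principle. *)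
Record monotone_C1_kernel {R : realType} (g ga gb : R -> R -> R) : Prop := MonotoneC1Kernel {
  kernel_d1 : forall a b : R, is_derive a 1 (g^~ b) (ga a b);
  kernel_d2 : forall a b : R, is_derive b 1 (g a) (gb a b);
  kernel_c1 : continuous2 ga;
  kernel_c2 : continuous2 gb;
  kernel_mono : forall a b, 0 <= gb a b }.

Section Kernel.
Context {R : realType} (g ga gb : R -> R -> R) (hg : monotone_C1_kernel g ga gb).

(** The increment is split at the corner [(p.1, q.2)] and each half is treated by the mean value
    theorem. Choice turns the intermediate points into functions of the endpoints, so that limits
    can be taken in them. *)
Lemma kernel_increment : exists c d : R * R -> R * R -> R, forall p q,
  [/\ `|c p q - p.1| <= `|q.1 - p.1|, `|d p q - p.2| <= `|q.2 - p.2|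
    & g q.1 q.2 - g p.1 p.2 =
      ga (c p q) q.2 * (q.1 - p.1) + gb p.1 (d p q) * (q.2 - p.2)].
Proof.
have H (p q : R * R) : exists r : R * R,
  [/\ `|r.1 - p.1| <= `|q.1 - p.1|, `|r.2 - p.2| <= `|q.2 - p.2|
    & g q.1 q.2 - g p.1 p.2 = ga r.1 q.2 * (q.1 - p.1) + gb p.1 r.2 * (q.2 - p.2)].
  have [c c1 c2] := mvt_increment (g^~ q.2) (ga^~ q.2)
    (fun x => kernel_d1 _ _ _ hg x q.2) p.1 q.1.
  have [d d1 d2] := mvt_increment (g p.1) (gb p.1) (kernel_d2 _ _ _ hg p.1) p.2 q.2.
  by exists (c, d); split => //=; rewrite -c2 -d2 /=; ring.
have [f Hf] := choice (fun pq : (R * R) * (R * R) => H pq.1 pq.2).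
by exists (fun p q => (f (p, q)).1), (fun p q => (f (p, q)).2) => p q; exact: (Hf (p, q)).
Qed.

Lemma kernel_continuous : continuous2 g.
Proof.
have [c [d H]] := kernel_increment.
move=> p; suff : (g q.1 q.2 - g p.1 p.2) @[q --> p] --> (0 : R).
  move=> K; have : (g p.1 p.2 + (g q.1 q.2 - g p.1 p.2)) @[q --> p] --> g p.1 p.2 + 0.
    by apply: cvgD => //; exact: cvg_cst.
  by rewrite addr0; under eq_fun do rewrite addrC subrK.
have -> : (fun q => g q.1 q.2 - g p.1 p.2) =
    (fun q => ga (c p q) q.2 * (q.1 - p.1) + gb p.1 (d p q) * (q.2 - p.2)).
  by apply/funext => q; case: (H p q).
have c1 : q.1 @[q --> p] --> p.1 by exact: cvg_fst.
have c2 : q.2 @[q --> p] --> p.2 by exact: cvg_snd.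
rewrite (_ : 0 = ga p.1 p.2 * (p.1 - p.1) + gb p.1 p.2 * (p.2 - p.2)); last by ring.
apply: cvgD; apply: cvgM; try by apply: cvgB => //; exact: cvg_cst.
  apply: continuous2_cvg => //; first by case: hg.
  by apply: cvg_squeeze_dist c1 => q; case: (H p q).
apply: continuous2_cvg; [by case: hg | exact: cvg_cst|].
by apply: cvg_squeeze_dist c2 => q; case: (H p q).
Qed.

Lemma kernel_le a b b' : b <= b' -> g a b <= g a b'.
Proof.
move=> bb'; have [c _ E] := mvt_increment (g a) (gb a) (kernel_d2 _ _ _ hg a) b b'.
by rewrite -subr_ge0 E mulr_ge0 ?subr_ge0 //; case: hg.
Qed.

Context {N : nat}.
Implicit Types u v w : 'I_N -> R.

(** The difference [v' - v] solves a linear system whose weights are [gb] at intermediate points, so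
    the maximum principle applies: solving for [v] is nonexpansive in the sup norm. *)
Lemma Tmap_dist u v v' e : (forall i, `|Tmap g u v' i - Tmap g u v i| <= e) ->
  forall i, `|v' i - v i| <= e.
Proof.
have [c [d H]] := kernel_increment.
set q := fun i j => (u i - u j, v' i - v' j); set p := fun i j => (u i - u j, v i - v j).
move=> He; apply: (max_principle (fun i j => gb (u i - u j) (d (p i j) (q i j)))).
  by move=> i j; case: hg.
move=> i; suff <- : Tmap g u v' i - Tmap g u v i = v' i - v i +
    oplap (fun i j => gb (u i - u j) (d (p i j) (q i j))) (fun i => v' i - v i) i by [].
rewrite /Tmap opprD addrACA -sumrB; congr (_ + _); apply: eq_bigr => j _.
by case: (H (p i j) (q i j)) => _ _; rewrite /p /q /= subrr mulr0 add0r => ->; ring.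
Qed.

Lemma Tmap_inj u v v' : Tmap g u v =1 Tmap g u v' -> v =1 v'.
Proof.
move=> E i; apply/eqP; rewrite -subr_eq0 -normr_le0.
by apply: (Tmap_dist u v' v 0) => j; rewrite E subrr normr0.
Qed.

Lemma Tmap_cvg {S : Type} {F : set_system S} {FF : Filter F} (u v : S -> 'I_N -> R) u0 v0 :
  (forall i, u s i @[s --> F] --> u0 i) -> (forall i, v s i @[s --> F] --> v0 i) ->
  forall i, Tmap g (u s) (v s) i @[s --> F] --> Tmap g u0 v0 i.
Proof.
move=> cu cv i; apply: cvgD => //; apply: cvg_bigsum => j _.
by apply: continuous2_cvg; [exact: kernel_continuous| apply: cvgB | apply: cvgB].
Qed.

(** Inserting the limit [v0] into the system at [s] leaves a residual tending to 0, which
    [Tmap_dist] turns into a bound on [v s - v0]. *)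
Lemma Tmap_solution_cvg {S : Type} {F : set_system S} {FF : Filter F}
    (u v w : S -> 'I_N -> R) u0 v0 w0 :
  (forall s, Tmap g (u s) (v s) =1 w s) -> Tmap g u0 v0 =1 w0 ->
  (forall i, u s i @[s --> F] --> u0 i) -> (forall i, w s i @[s --> F] --> w0 i) ->
  forall i, v s i @[s --> F] --> v0 i.
Proof.
move=> Hs H0 cu cw i; apply/cvgrPdist_le => e e0.
have K k : (Tmap g (u s) v0 k - w s k) @[s --> F] --> (0 : R).
  rewrite -[X in _ --> X](_ : w0 k - w0 k = 0); last exact: subrr.
  apply: cvgB => //.
  by rewrite -H0; apply: Tmap_cvg => // l; exact: cvg_cst.
have K' : \forall s \near F, forall k, `|Tmap g (u s) v0 k - w s k| <= e.
  apply: filter_forall => k.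
  by move/cvgrPdist_le: (K k) => /(_ e e0); apply: filterS => s; rewrite distrC subr0.
apply: filterS K' => s Ks.
by apply: (Tmap_dist (u s)) => k; rewrite Hs.
Qed.

(** The difference quotients of [v] solve linear systems whose weights and right-hand sides converge
    to those of the system for [D]; hence the quotients converge to [D]. *)
Lemma Tmap_solution_derive (u v w : R -> 'I_N -> R) (u' w' D : 'I_N -> R) (t : R) :
  (forall s, Tmap g (u s) (v s) =1 w s) ->
  (forall i, is_derive t 1 (u^~ i) (u' i)) -> (forall i, is_derive t 1 (w^~ i) (w' i)) ->
  (forall i, D i + oplap (fun i j => gb (u t i - u t j) (v t i - v t j)) D i =
    w' i - oplap (fun i j => ga (u t i - u t j) (v t i - v t j)) u' i) ->
  forall i, is_derive t 1 (v^~ i) (D i).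
Proof.
move=> HT Hu Hw HD.
have [c [d H]] := kernel_increment.
pose q h i j := (u (h + t) i - u (h + t) j, v (h + t) i - v (h + t) j).
pose p i j := (u t i - u t j, v t i - v t j).
have cu i : u (h + t) i @[h --> 0^'] --> u t i by exact: (cvg_shift_dnbhs (u^~ i) t (u' i)).
have cw i : w (h + t) i @[h --> 0^'] --> w t i by exact: (cvg_shift_dnbhs (w^~ i) t (w' i)).
(* Continuity of [v] comes first, because the intermediate points in the weights converge only with
   it. *)
have cv i : v (h + t) i @[h --> 0^'] --> v t i.
  exact: (Tmap_solution_cvg (fun h => u (h + t)) (fun h => v (h + t)) (fun h => w (h + t))
    (u t) (v t) (w t)).
have cq1 i j : (q h i j).1 @[h --> 0^'] --> (p i j).1 by apply: cvgB.
have cq2 i j : (q h i j).2 @[h --> 0^'] --> (p i j).2 by apply: cvgB.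
move=> i; apply/is_derive_quotientP.
pose Du h k := h^-1 * (u (h + t) k - u t k).
pose A h i j := ga (c (p i j) (q h i j)) (q h i j).2.
apply: (oplap_solution_cvg (fun h i j => gb (p i j).1 (d (p i j) (q h i j)))
  (fun h k => h^-1 * (v (h + t) k - v t k))
  (fun h k => h^-1 * (w (h + t) k - w t k) - oplap (A h) (Du h) k) _ _ _ _ _ _ _ HD).
- by move=> h k l; case: hg.
- move=> k l; apply: continuous2_cvg; [by case: hg|exact: cvg_cst|].
  by apply: cvg_squeeze_dist (cq2 k l) => h; case: (H (p k l) (q h k l)).
- move=> k; apply: cvgB; first by apply/is_derive_quotientP.
  apply: oplap_cvg => [m l|l]; last by apply/is_derive_quotientP.
  apply: continuous2_cvg; [by case: hg| |exact: cq2].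
  by apply: cvg_squeeze_dist (cq1 m l) => h; case: (H (p m l) (q h m l)).
(* By linearity this is [h^-1] times the increment of the equation [Tmap g u v = w], expanded by
   [kernel_increment]. *)
- near=> h => k; rewrite !oplapZ -mulrDr -mulrBr -!HT; congr (_ * _).
  rewrite /Tmap opprD addrACA -sumrB -[RHS]addrA; congr (_ + _).
  apply/eqP; rewrite eq_sym subr_eq -big_split; apply/eqP/eq_bigr => l _.
  by case: (H (p k l) (q h k l)) => _ _ /= ->; rewrite /A /=; ring.
Unshelve. all: by end_near.
Qed.

End Kernel.

(** * Existence of solutions of the monotone systems *)

Section Perron.
Context {R : realType} (g ga gb : R -> R -> R) (hg : monotone_C1_kernel g ga gb) {N : nat}.
Implicit Types u v w : 'I_N -> R.

(* Perron's method: the pointwise supremum of all subsolutions is a solution. *)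
Lemma Tmap_surj u w : exists v, Tmap g u v =1 w.
Proof.
(* [G] is the interaction sum of a constant [v], so the constant [- M] is a subsolution. At its
   largest entry any subsolution has interaction sum at least [G], hence is bounded by [M]. *)
pose G i := \sum_(j < N | j != i) g (u i - u j) 0.
pose M := \sum_i (`|w i| + `|G i|).
have MG i : `|w i| + `|G i| <= M.
  by rewrite /M (bigD1 i) //= lerDl sumr_ge0 // => j _; rewrite addr_ge0.
pose S := [set v : 'I_N -> R | forall i, Tmap g u v i <= w i].
have S0 : S (fun=> - M).
  move=> i; rewrite /Tmap (eq_bigr (fun j => g (u i - u j) 0)) => [|j _]; last by rewrite subrr.
  by have := MG i; have := ler_norm (- w i); have := ler_norm (G i); rewrite normrN -/(G i); lra.
have SM v i : S v -> v i <= M.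
  move=> Sv; have [k vk] := exists_argmax v i; apply: le_trans (vk i) _.
  have : v k + G k <= w k.
    apply: le_trans (Sv k); rewrite lerD2l; apply: ler_sum => j _.
    by apply: kernel_le; [exact: hg | rewrite subr_ge0].
  by have := MG k; have := ler_norm (w k); have := ler_norm (- G k); rewrite normrN; lra.
pose A i := [set v i | v in S].
have supA i : has_sup (A i).
  by split; [exists (- M); exists (fun=> - M) | exists M => _ [v Sv <-]; exact: SM].
pose V i := sup (A i).
have SV v i : S v -> v i <= V i.
  by move=> Sv; apply: ub_le_sup; [exact: (supA i).2 | exists v].
(* The [i]-th equation as a function of its own unknown, the other entries being frozen at [V]. *)
pose f i (t : R) := t + \sum_(j < N | j != i) g (u i - u j) (t - V j).
have cf i : f i t @[t --> V i] --> Tmap g u V i.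
  apply: cvgD; first exact: cvg_id.
  apply: cvg_bigsum => j _; apply: continuous2_cvg.
  - exact: kernel_continuous hg.
  - exact: cvg_cst.
  - by apply: cvgB; [exact: cvg_id | exact: cvg_cst].
(* If equation [i] were too large at [V], then [f i] would be too large near [V i], in particular at
   [v i] for some subsolution [v]. But [v <= V] and monotonicity give
   [f i (v i) <= Tmap g u v i <= w i]. *)
have VS : S V.
  move=> i; rewrite leNgt; apply/negP => /(cvgr_gt (Tmap g u V i) (cf i)).
  move=> /nbhs_ballP [e /= e0 He].
  have [_ [v Sv <-] lt] := sup_adherent e0 (supA i).
  have : w i < f i (v i).
    by apply: He; rewrite /ball /= ger0_norm ?subr_ge0 ?SV //; move: lt; rewrite -/(V i); lra.
  rewrite ltNge => /negP; apply; apply: le_trans (Sv i).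
  rewrite lerD2l; apply: ler_sum => j _; apply: kernel_le; first exact: hg.
  by rewrite lerD2l lerN2 SV.
exists V => i; apply: le_anti; rewrite VS /=.
rewrite leNgt; apply/negP => /(cvgr_lt (Tmap g u V i) (cf i)).
move=> /nbhs_ballP [e /= e0 He].
(* If equation [i] were strict, entry [i] could be raised slightly: the other equations can only
   decrease, so [V'] would be a subsolution exceeding the supremum. Half of [e] stays inside the
   ball. *)
pose V' j := if j == i then V i + e / 2 else V j.
have V'ge j : V j <= V' j by rewrite /V'; case: eqP => // ->; lra.
have : S V'.
  move=> k; have [->|ki] := eqVneq k i.
    have -> : Tmap g u V' i = f i (V i + e / 2).
      rewrite /Tmap /f /V' eqxx; congr (_ + _); apply: eq_bigr => j ji.
      by rewrite (negbTE ji).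
    apply/ltW/He; rewrite /ball /= opprD addrA subrr sub0r normrN ger0_norm; lra.
  apply: le_trans (VS k); rewrite /Tmap {1}/V' (negbTE ki) lerD2l.
  apply: ler_sum => j _; apply: kernel_le; first exact: hg.
  by rewrite {1}/V' (negbTE ki) lerD2l lerN2.
by move=> /(SV _ i); rewrite /V' eqxx; lra.
Qed.

End Perron.

(** * Partial derivatives, symmetry of mixed derivatives and parity *)

Lemma cvg_rV {R : realType} {S : Type} {n : nat} {F : set_system S} {FF : Filter F}
    (f : S -> 'rV[R]_n) (z : 'rV[R]_n) :
  (forall k, f s ord0 k @[s --> F] --> z ord0 k) -> f s @[s --> F] --> z.
Proof.
move=> H A [P HP PA]; apply: (@filterS _ F _ _ _ (fun s => PA (f s))) => /=.
apply: filter_forall => i; apply: filter_forall => k; rewrite ord1.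
by apply: H; have := HP i k; rewrite ord1.
Qed.

(** Reduces a partial derivative to the derivative along a coordinate line, so that results about
    curves apply. *)
Lemma is_pdP {R : realType} {n : nat} (f : 'rV[R]_n -> R) k z (l : R) :
  is_derive z (delta_mx ord0 k) f l <->
  is_derive (0 : R) 1 (fun s => f (s *: delta_mx ord0 k + z)) l.
Proof.
rewrite is_derive_quotientP.
have E : (fun h : R => h^-1 *: ((f \o shift z) (h *: delta_mx ord0 k) - f z)) =
         (fun h => h^-1 * (f ((h + 0) *: delta_mx ord0 k + z) - f (0 *: delta_mx ord0 k + z))).
  by apply/funext => h /=; rewrite addr0 scale0r add0r.
split=> [[df <-]|H].
  by move: df; rewrite /derivable /derive E.
by split; rewrite /derivable /derive E; [apply/cvg_ex; exists l | exact: cvg_lim].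
Qed.

Lemma is_pd {R : realType} {n : nat} (f : 'rV[R]_n -> R) k z :
  derivable f z (delta_mx ord0 k) -> is_derive z (delta_mx ord0 k) f (pd f k z).
Proof. by move=> df; split. Qed.

Lemma pt2_continuous {R : realType} (f : 'rV[R]_2 -> R) :
  continuous f -> continuous2 (fun a b => f (pt2 a b)).
Proof.
move=> cf p; apply: (@cvg_comp _ _ _ (fun q : R * R => pt2 q.1 q.2) f); last exact: cf.
apply: cvg_rV => k; rewrite mxE; under eq_fun do rewrite mxE.
by case: eqP => _; [exact: cvg_fst | exact: cvg_snd].
Qed.

Lemma pt2_d1 {R : realType} (f : 'rV[R]_2 -> R) (a b : R) :
  derivable f (pt2 a b) (delta_mx ord0 (i0 : 'I_2)) ->
  is_derive a 1 (fun x => f (pt2 x b)) (pd f i0 (pt2 a b)).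
Proof.
move=> /is_pd /is_pdP /is_derive_quotientP H; apply/is_derive_quotientP.
rewrite [X in X @ _](_ : _ = (fun h => h^-1 * (f ((h + 0) *: delta_mx ord0 i0 + pt2 a b)
  - f (0 *: delta_mx ord0 i0 + pt2 a b)))) //.
apply/funext => h; congr (_ * (f _ - f _)); apply/rowP => k; rewrite !mxE /= ?mul0r ?add0r //.
by case: eqP => _; rewrite ?mulr1 ?mulr0 ?addr0 ?add0r.
Qed.

Lemma pt2_d2 {R : realType} (f : 'rV[R]_2 -> R) (a b : R) :
  derivable f (pt2 a b) (delta_mx ord0 (i1 : 'I_2)) ->
  is_derive b 1 (fun x => f (pt2 a x)) (pd f i1 (pt2 a b)).
Proof.
move=> /is_pd /is_pdP /is_derive_quotientP H; apply/is_derive_quotientP.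
rewrite [X in X @ _](_ : _ = (fun h => h^-1 * (f ((h + 0) *: delta_mx ord0 i1 + pt2 a b)
  - f (0 *: delta_mx ord0 i1 + pt2 a b)))) //.
apply/funext => h; congr (_ * (f _ - f _)); apply/rowP => k; rewrite !mxE /= ?mul0r ?add0r //.
by case: k => [[|[|//]] ?] /=; rewrite ?mulr1 ?mulr0 ?addr0 ?add0r.
Qed.

(** Schwarz's theorem: the second difference of [f] over a square of side [h] is [h^2] times [fab]
    at one intermediate point and [h^2] times [fba] at another; then [h] tends to 0. *)
Lemma mixed_derivatives_comm {R : realType} (f fa fb fab fba : R -> R -> R) :
  (forall a b : R, is_derive a 1 (f^~ b) (fa a b)) ->
  (forall a b : R, is_derive b 1 (f a) (fb a b)) ->
  (forall a b : R, is_derive b 1 (fa a) (fab a b)) ->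
  (forall a b : R, is_derive a 1 (fb^~ b) (fba a b)) ->
  continuous2 fab -> continuous2 fba -> forall a b, fab a b = fba a b.
Proof.
move=> Ha Hb Hab Hba cab cba a b.
have H (h : R) : exists r : (R * R) * (R * R),
    [/\ `|r.1.1 - a| <= `|h|, `|r.1.2 - b| <= `|h|, `|r.2.1 - a| <= `|h|,
        `|r.2.2 - b| <= `|h| & h != 0 -> fab r.1.1 r.1.2 = fba r.2.1 r.2.2].
  have [c c1 c2] := mvt_increment (fun x => f x (b + h) - f x b)
    (fun x => fa x (b + h) - fa x b) (fun x => is_deriveB (Ha x (b + h)) (Ha x b)) a (a + h).
  have [d d1 d2] := mvt_increment (fa c) (fab c) (Hab c) b (b + h).
  have [c' c'1 c'2] := mvt_increment (fun y => f (a + h) y - f a y)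
    (fun y => fb (a + h) y - fb a y) (fun y => is_deriveB (Hb (a + h) y) (Hb a y)) b (b + h).
  have [d' d'1 d'2] := mvt_increment (fb^~ c') (fba^~ c') (fun x => Hba x c') a (a + h).
  have E (x : R) : x + h - x = h by rewrite addrAC subrr add0r.
  move: c1 d1 c'1 d'1; rewrite !E => c1 d1 c'1 d'1.
  exists ((c, d), (d', c')); split => //= h0.
  apply: (mulIf h0); apply: (mulIf h0).
  by move: c2 c'2; rewrite d2 d'2 !E => <- <-; ring.
have [r Hr] := choice H.
have sq (k : R -> R) (l : R) : (forall h, `|k h - l| <= `|h|) -> k h @[h --> 0^'] --> l.
  move=> kl; apply: (cvg_squeeze_dist (fun h => h + l)).
    by move=> h; rewrite addrK.
  rewrite -[X in _ --> X]add0r; apply: cvgD; last exact: cvg_cst.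
  by move=> A; apply: cvg_within.
have C1 : fab (r h).1.1 (r h).1.2 @[h --> 0^'] --> fab a b.
  by apply: continuous2_cvg => //; apply: sq => h; case: (Hr h).
have C2 : fba (r h).2.1 (r h).2.2 @[h --> 0^'] --> fba a b.
  by apply: continuous2_cvg => //; apply: sq => h; case: (Hr h).
have C3 : fab (r h).1.1 (r h).1.2 @[h --> 0^'] --> fba a b.
  apply: cvg_trans C2; apply: near_eq_cvg; near=> h.
  by case: (Hr h) => _ _ _ _ ->//; near: h; exact: nbhs_dnbhs_neq.
exact: (cvg_unique _ C1 C3).
Unshelve. all: by end_near.
Qed.

Lemma continuous2_swap {R : realType} (f : R -> R -> R) :
  continuous2 f -> continuous2 (fun a b => f b a).
Proof.
by move=> cf p; apply: continuous2_cvg => //; [exact: cvg_snd | exact: cvg_fst].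
Qed.

(** Chain rule through [x -> - x]. The sign [s] is the parity and each derivative flips it: from the
    evenness of psi, first derivatives are odd and second ones even. *)
Lemma odd_derivative {R : realType} (s : R) (f df : R -> R -> R) :
  (forall a b : R, is_derive a 1 (f^~ b) (df a b)) ->
  (forall a b, f (- a) (- b) = s * f a b) -> forall a b, df (- a) (- b) = - s * df a b.
Proof.
move=> Hf E a b.
have H1 : is_derive a 1 (fun x => f (- x) (- b)) (df (- a) (- b) * - 1).
  have Hn : is_derive a 1 (fun x : R => - x) (- 1) by exact: is_deriveN.
  exact: (@is_derive1_comp _ (f^~ (- b)) (fun x : R => - x) a _ _ (Hf (- a) (- b)) Hn).
have H2 : is_derive a 1 (fun x => f (- x) (- b)) (s * df a b).
  rewrite (_ : (fun x => _) = (fun x => s * f x b)); last by apply/funext.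
  exact: (is_deriveZ s (Hf a b)).
have := @derive_val _ _ _ _ _ _ _ H1; rewrite (@derive_val _ _ _ _ _ _ _ H2); lra.
Qed.

(** * The two kernels obtained from psi *)

Definition psixx {R : realType} (psi : R -> R -> R) (a b : R) : R :=
  pd (pd (psi2 psi) i0) i0 (pt2 a b).
Definition psithth {R : realType} (psi : R -> R -> R) (a b : R) : R :=
  pd (pd (psi2 psi) i1) i1 (pt2 a b).

Section Psi.
Context {R : realType} (psi : R -> R -> R).
Hypotheses (hC2 : C2 (psi2 psi)) (hmix : forall x th : R, 0 <= psixth psi x th)
  (hsym : forall x th : R, psi (- x) (- th) = psi x th).

Let psi_d1 (a b : R) : is_derive a 1 (psi^~ b) (psix psi a b).
Proof.
have := pt2_d1 (psi2 psi) a b (hC2.1.1 _ _).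
by rewrite (_ : (fun x => _) = psi^~ b) //; apply/funext => x; rewrite /psi2 !mxE.
Qed.

Let psi_d2 (a b : R) : is_derive b 1 (psi a) (psith psi a b).
Proof.
have := pt2_d2 (psi2 psi) a b (hC2.1.1 _ _).
by rewrite (_ : (fun x => _) = psi a) //; apply/funext => x; rewrite /psi2 !mxE.
Qed.

Let psixx_d1 (a b : R) : is_derive a 1 ((psix psi)^~ b) (psixx psi a b).
Proof. exact: (pt2_d1 (pd (psi2 psi) i0) a b ((hC2.2 _).1 _ _)). Qed.

Let psixth_d2 (a b : R) : is_derive b 1 (psix psi a) (psixth psi a b).
Proof. exact: (pt2_d2 (pd (psi2 psi) i0) a b ((hC2.2 _).1 _ _)). Qed.

Let psith_d2 (a b : R) : is_derive b 1 (psith psi a) (psithth psi a b).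
Proof. exact: (pt2_d2 (pd (psi2 psi) i1) a b ((hC2.2 _).1 _ _)). Qed.

(** [psixth] differentiates in [x] first. Symmetry of mixed derivatives makes it also the
    [x]-derivative of [psith], so one sign hypothesis serves both kernels. *)
Let psixth_d1 (a b : R) : is_derive a 1 ((psith psi)^~ b) (psixth psi a b).
Proof.
have psithx_d1 (c d : R) :
    is_derive c 1 ((psith psi)^~ d) (pd (pd (psi2 psi) i1) i0 (pt2 c d)).
  exact: (pt2_d1 (pd (psi2 psi) i1) c d ((hC2.2 _).1 _ _)).
rewrite (_ : psixth psi a b = pd (pd (psi2 psi) i1) i0 (pt2 a b)); first exact: psithx_d1.
exact: (mixed_derivatives_comm psi (psix psi) (psith psi) (psixth psi)
  (fun a b => pd (pd (psi2 psi) i1) i0 (pt2 a b)) psi_d1 psi_d2 psixth_d2 psithx_d1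
  (pt2_continuous _ ((hC2.2 i0).2 i1)) (pt2_continuous _ ((hC2.2 i1).2 i0)) a b).
Qed.

Lemma psixx_even a b : psixx psi (- a) (- b) = psixx psi a b.
Proof.
rewrite (odd_derivative (- 1) _ _ psixx_d1) ?opprK ?mul1r // => {}a {}b.
by rewrite (odd_derivative 1 _ _ psi_d1) // => {}a {}b; rewrite hsym mul1r.
Qed.

Lemma psith_odd a b : psith psi (- a) (- b) = - psith psi a b.
Proof.
have H c d : psi (- d) (- c) = 1 * psi d c by rewrite hsym mul1r.
have := odd_derivative 1 (fun b a => psi a b) (fun b a => psith psi a b)
  (fun b a => psi_d2 a b) H b a.
by rewrite mulN1r.
Qed.

Lemma psixth_even a b : psixth psi (- a) (- b) = psixth psi a b.
Proof.
rewrite (odd_derivative (- 1) _ _ psixth_d1) ?opprK ?mul1r // => {}a {}b.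
by rewrite psith_odd mulN1r.
Qed.

Lemma psix_kernel : monotone_C1_kernel (psix psi) (psixx psi) (psixth psi).
Proof.
exact: (MonotoneC1Kernel _ _ _ _ psixx_d1 psixth_d2
  (pt2_continuous _ ((hC2.2 i0).2 i0)) (pt2_continuous _ ((hC2.2 i0).2 i1)) hmix).
Qed.

(** The arguments are swapped because the [y]-equation is solved for [x] at fixed theta, and the
    unknown must enter through the second argument. *)
Lemma psith_kernel : monotone_C1_kernel (fun b a => psith psi a b)
  (fun th x => psithth psi x th) (fun th x => psixth psi x th).
Proof.
exact: (MonotoneC1Kernel _ _ _ _ (fun a b => psith_d2 b a) (fun a b => psixth_d1 b a)
  (continuous2_swap _ (pt2_continuous _ ((hC2.2 i1).2 i1)))
  (continuous2_swap _ (pt2_continuous _ ((hC2.2 i0).2 i1))) (fun a b => hmix b a)).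
Qed.

(** * The map [omega], its right inverse and the characterisation of theta *)

Section Omega.
Context {N : nat}.
Implicit Types (y th : 'rV[R]_N) (z : 'rV[R]_(N + N)).

(** Perron's method provides the existence required by the choice operator in [omega_x]. *)
Lemma omega_xP y th :
  Tmap (fun b a => psith psi a b) (th ord0) (omega_x psi y th ord0) =1 y ord0.
Proof.
move=> i; have [v Hv] := Tmap_surj _ _ _ psith_kernel (th ord0) (y ord0).
suff /(ClassicalEpsilon.epsilon_spec (inhabits 0)) /(_ i) -> : exists x : 'rV[R]_N, forall i : 'I_N,
  y ord0 i = x ord0 i +
    \sum_(j < N | j != i) psith psi (x ord0 i - x ord0 j) (th ord0 i - th ord0 j) by [].
exists (\row_i v i) => k; rewrite -Hv mxE; congr (_ + _).
by apply: eq_bigr => j _; rewrite !mxE.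
Qed.

Lemma omega_x_unique y th (x : 'rV[R]_N) :
  Tmap (fun b a => psith psi a b) (th ord0) (x ord0) =1 y ord0 -> omega_x psi y th = x.
Proof.
move=> H; apply/rowP; apply: (Tmap_inj _ _ _ psith_kernel (th ord0)) => i.
by rewrite omega_xP H.
Qed.

Lemma xs_omega (w : 'rV[R]_(N + N)) :
  xs (omega psi w) = omega_x psi (lsubmx w) (rsubmx w) ord0.
Proof. by apply/funext => i; rewrite /xs row_mxEl. Qed.

Lemma ps_omega (w : 'rV[R]_(N + N)) :
  Tmap (psix psi) (xs (omega psi w)) (rsubmx w ord0) =1 ps (omega psi w).
Proof. by move=> i; rewrite xs_omega /ps row_mxEr mxE. Qed.

Lemma omega_eq y th z :
  Tmap (fun b a => psith psi a b) (th ord0) (xs z) =1 y ord0 ->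
  Tmap (psix psi) (xs z) (th ord0) =1 ps z -> omega psi (row_mx y th) = z.
Proof.
move=> Hy Hth.
have E : omega_x psi y th = lsubmx z.
  apply: omega_x_unique => i; rewrite -Hy; congr (Tmap _ _ _ i).
  by apply/funext => j; rewrite mxE.
have Ex : xs (omega psi (row_mx y th)) = xs z.
  by rewrite xs_omega row_mxKl row_mxKr E; apply/funext => j; rewrite mxE.
apply/rowP => i; case: (split_ordP i) => j ->; first by have := congr1 (@^~ j) Ex.
by rewrite -[LHS]/(ps (omega psi (row_mx y th)) j) -ps_omega Ex row_mxKr Hth.
Qed.

(** A preimage of [(x, p)] is built by solving the [p]-equation for theta and then reading [y] off
    the other equation. *)
Lemma omega_invK z : omega psi (omega_inv psi z) = z.
Proof.
apply: (ClassicalEpsilon.epsilon_spec (inhabits 0) (fun w => omega psi w = z)).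
have [th Hth] := Tmap_surj _ _ _ psix_kernel (xs z) (ps z).
exists (row_mx (\row_i Tmap (fun b a => psith psi a b) th (xs z) i) (\row_i th i)).
have E : (\row_i th i) ord0 = th by apply/funext => i; rewrite mxE.
by apply: omega_eq; rewrite E // => i; rewrite mxE.
Qed.

Lemma thetafP z : Tmap (psix psi) (xs z) (thetaf psi z) =1 ps z.
Proof. by move=> i; have := ps_omega (omega_inv psi z) i; rewrite omega_invK. Qed.

(** The [p]-equation alone pins down theta; later values of [thetaf] are identified by checking
    it. *)
Lemma thetaf_unique z (th : 'I_N -> R) :
  Tmap (psix psi) (xs z) th =1 ps z -> thetaf psi z =1 th.
Proof.
by move=> H; apply: (Tmap_inj _ _ _ psix_kernel (xs z)) => i; rewrite thetafP H.
Qed.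

End Omega.
End Psi.

(** * Laplacian matrices, their resolvents and implicit differentiation in matrix form *)

Section LaplacianMatrix.
Context {R : realType} {N : nat}.
Implicit Types (c : 'I_N -> 'I_N -> R) (d r : 'cV[R]_N).

Definition lapmx c : 'M[R]_N :=
  \matrix_(i, j) ((\sum_(k < N | k != i) c i k) *+ (i == j) - c i j *+ (j != i)).

Definition resmx c : 'M[R]_N := invmx (1%:M + lapmx c).

Lemma mul_lapmx c d i : (lapmx c *m d) i 0 = oplap c (d^~ 0) i.
Proof.
rewrite mxE (bigD1 i) //= !mxE !eqxx subr0 mulr_suml /oplap.
rewrite -big_split /=; apply: eq_bigr => j ji.
by rewrite mxE ji eq_sym (negbTE ji) sub0r mulr1n; ring.
Qed.

Lemma lapmx_sym c : (forall i j, c i j = c j i) -> (lapmx c)^T = lapmx c.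
Proof.
move=> cs; apply/matrixP => i j; rewrite !mxE cs (eq_sym j i).
by have [->|_] := eqVneq i j.
Qed.

(** A kernel vector solves the homogeneous system, so it vanishes by the maximum principle. *)
Lemma lapmx_unit c : (forall i j, 0 <= c i j) -> 1%:M + lapmx c \in unitmx.
Proof.
move=> c0; rewrite -unitmx_tr -row_free_unit; apply: inj_row_free => v H.
have {}H : (1%:M + lapmx c) *m v^T = 0 by apply: trmx_inj; rewrite trmx_mul trmxK H trmx0.
suff E : (v^T)^~ 0 =1 fun=> 0 by apply/rowP => i; have := E i; rewrite !mxE.
apply: (oplap_solution_unique c) => // i.
rewrite -mul_lapmx (_ : _ + _ = ((1%:M + lapmx c) *m v^T) i 0); last first.
  by rewrite mulmxDl mul1mx [RHS]mxE.
by rewrite H mxE add0r /oplap big1 // => j _; rewrite subrr mulr0.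
Qed.

Lemma resmx_solution c r : (forall i j, 0 <= c i j) ->
  forall i, (resmx c *m r) i 0 + oplap c ((resmx c *m r)^~ 0) i = r i 0.
Proof.
move=> c0 i; rewrite -mul_lapmx (_ : _ + _ = ((1%:M + lapmx c) *m (resmx c *m r)) i 0); last first.
  by rewrite mulmxDl mul1mx [RHS]mxE.
by rewrite mulmxA mulmxV ?lapmx_unit // mul1mx.
Qed.

Lemma resmx_sym c : (forall i j, c i j = c j i) -> (resmx c)^T = resmx c.
Proof. by move=> cs; rewrite trmx_inv linearD /= trmx1 lapmx_sym. Qed.

Lemma resmx_unit c : (forall i j, 0 <= c i j) -> resmx c \in unitmx.
Proof. by move=> c0; rewrite unitmx_inv lapmx_unit. Qed.

(** Continuity of the inverse matrix is obtained from the stability of solutions of the linear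
    system. *)
Lemma resmx_cvg {S : Type} {F : set_system S} {FF : Filter F}
    (c : S -> 'I_N -> 'I_N -> R) (r : S -> 'cV[R]_N) c0 r0 :
  (forall s i j, 0 <= c s i j) -> (forall i j, 0 <= c0 i j) ->
  (forall i j, c s i j @[s --> F] --> c0 i j) ->
  (forall i, r s i 0 @[s --> F] --> r0 i 0) ->
  forall i, (resmx (c s) *m r s) i 0 @[s --> F] --> (resmx c0 *m r0) i 0.
Proof.
move=> cge c0ge cc cr.
apply: (oplap_solution_cvg c (fun s => (resmx (c s) *m r s)^~ 0) (fun s => (r s)^~ 0) c0
  ((resmx c0 *m r0)^~ 0) (r0^~ 0)) => //.
- by apply: nearW => s; exact: resmx_solution.
- exact: resmx_solution.
Qed.

Lemma lapmx_cvg {S : Type} {F : set_system S} {FF : Filter F}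
    (c : S -> 'I_N -> 'I_N -> R) (r : S -> 'cV[R]_N) c0 r0 :
  (forall i j, c s i j @[s --> F] --> c0 i j) ->
  (forall i, r s i 0 @[s --> F] --> r0 i 0) ->
  forall i, (lapmx (c s) *m r s) i 0 @[s --> F] --> (lapmx c0 *m r0) i 0.
Proof.
move=> cc cr i; rewrite mul_lapmx; under eq_fun do rewrite mul_lapmx.
exact: (oplap_cvg c (fun s => (r s)^~ 0) c0 (r0^~ 0)).
Qed.

End LaplacianMatrix.

Definition pairmx {R : realType} {N : nat} (f : R -> R -> R) (u v : 'I_N -> R) (i j : 'I_N) :=
  f (u i - u j) (v i - v j).

Lemma pairmx_sym {R : realType} {N : nat} (f : R -> R -> R) (u v : 'I_N -> R) :
  (forall a b, f (- a) (- b) = f a b) -> forall i j, pairmx f u v i j = pairmx f u v j i.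
Proof. by move=> fE i j; rewrite /pairmx -fE !opprB. Qed.

Lemma Tmap_solution_derive_mx {R : realType} (g ga gb : R -> R -> R) {N : nat}
    (u v w : R -> 'I_N -> R) (u' w' : 'cV[R]_N) (t : R) :
  monotone_C1_kernel g ga gb ->
  (forall s, Tmap g (u s) (v s) =1 w s) ->
  (forall i, is_derive t 1 (u^~ i) (u' i 0)) -> (forall i, is_derive t 1 (w^~ i) (w' i 0)) ->
  forall i, is_derive t 1 (v^~ i) ((resmx (pairmx gb (u t) (v t)) *m
    (w' - lapmx (pairmx ga (u t) (v t)) *m u')) i 0).
Proof.
move=> hg HT Hu Hw; set r := w' - _.
apply: (Tmap_solution_derive _ _ _ hg u v w (u'^~ 0) (w'^~ 0)
  ((resmx (pairmx gb (u t) (v t)) *m r)^~ 0)) => // i.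
rewrite -/(pairmx gb (u t) (v t)) resmx_solution; last by move=> k l; exact: (kernel_mono _ _ _ hg).
by rewrite /r mxE mxE mul_lapmx.
Qed.

Lemma is_derive_affine {R : realType} (a b t : R) : is_derive t 1 (fun s : R => s * a + b) a.
Proof.
apply/is_derive_quotientP; apply: (@cvg_trans _ ((fun=> a) @ (0 : R)^')).
  apply: near_eq_cvg; near=> h; have h0 : h != 0 by near: h; exact: nbhs_dnbhs_neq.
  by field.
exact: cvg_cst.
Unshelve. all: by end_near.
Qed.

(** * First derivatives of theta and their continuity *)

Section Theta.
Context {R : realType} (psi : R -> R -> R) {N : nat}.
Hypotheses (hC2 : C2 (psi2 psi)) (hmix : forall x th : R, 0 <= psixth psi x th)
  (hsym : forall x th : R, psi (- x) (- th) = psi x th).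
Implicit Types (z : 'rV[R]_(N + N)).

Let kx := psix_kernel psi hC2 hmix.

(** [theta_res] and [theta_lap] are the matrices X and L in [theta' = X (p' - L x')]. *)
Definition theta_res z := resmx (pairmx (psixth psi) (xs z) (thetaf psi z)).
Definition theta_lap z := lapmx (pairmx (psixx psi) (xs z) (thetaf psi z)).

Lemma theta_lap_sym z : (theta_lap z)^T = theta_lap z.
Proof. by apply/lapmx_sym/pairmx_sym => a b; exact: psixx_even. Qed.

Lemma theta_res_sym z : (theta_res z)^T = theta_res z.
Proof. by apply/resmx_sym/pairmx_sym => a b; exact: psixth_even. Qed.

Lemma theta_res_unit z : theta_res z \in unitmx.
Proof. by apply: resmx_unit => i j; exact: hmix. Qed.

Lemma theta_derive_curve (gamma : R -> 'rV[R]_(N + N)) (x' p' : 'cV[R]_N) (t : R) :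
  (forall i, is_derive t 1 (fun s => xs (gamma s) i) (x' i 0)) ->
  (forall i, is_derive t 1 (fun s => ps (gamma s) i) (p' i 0)) ->
  forall i, is_derive t 1 (fun s => thetaf psi (gamma s) i)
    ((theta_res (gamma t) *m (p' - theta_lap (gamma t) *m x')) i 0).
Proof.
move=> Hx Hp; apply: (Tmap_solution_derive_mx (psix psi) (psixx psi) (psixth psi)
  (fun s => xs (gamma s)) (fun s => thetaf psi (gamma s)) (fun s => ps (gamma s))) => //.
by move=> s; exact: thetafP.
Qed.

(** The formula [X (p' - L x')] along the [m]-th coordinate line: entry [k] is the [m]-th partial
    derivative of [theta_k]. *)
Definition theta_grad z m : 'cV[R]_N := let e : 'rV[R]_(N + N) := delta_mx ord0 m in
  theta_res z *m ((rsubmx e)^T - theta_lap z *m (lsubmx e)^T).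

Lemma theta_pd z k m :
  is_derive z (delta_mx ord0 m) (fun z => thetaf psi z k) (theta_grad z m k 0).
Proof.
apply/is_pdP; set e := delta_mx ord0 m.
have := theta_derive_curve (fun s => s *: e + z) (lsubmx e)^T (rsubmx e)^T 0.
rewrite scale0r add0r; apply=> i.
  rewrite (_ : (fun s => _) = fun s => s * (lsubmx e)^T i 0 + xs z i).
    exact: is_derive_affine.
  by apply/funext => s; rewrite /xs !mxE.
rewrite (_ : (fun s => _) = fun s => s * (rsubmx e)^T i 0 + ps z i).
  exact: is_derive_affine.
by apply/funext => s; rewrite /ps !mxE.
Qed.

Lemma thetaf_cvg z k : thetaf psi z' k @[z' --> z] --> thetaf psi z k.
Proof.
apply: (@Tmap_solution_cvg _ _ _ _ kx _ _ (nbhs z) _ (fun z => xs z)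
  (fun z => thetaf psi z) (fun z => ps z) (xs z) (thetaf psi z) (ps z)).
- by move=> s; exact: thetafP.
- exact: thetafP.
- by move=> i; exact: coord_continuous.
- by move=> i; exact: coord_continuous.
Qed.

Lemma pairmx_theta_cvg (f : R -> R -> R) z i j : continuous2 f ->
  pairmx f (xs z') (thetaf psi z') i j @[z' --> z] --> pairmx f (xs z) (thetaf psi z) i j.
Proof.
move=> cf; apply: (@continuous2_cvg _ _ (nbhs z)) => //; apply: cvgB; try exact: coord_continuous.
  exact: thetaf_cvg.
exact: thetaf_cvg.
Qed.

Lemma theta_grad_cvg z m k : theta_grad z' m k 0 @[z' --> z] --> theta_grad z m k 0.
Proof.
apply: (@resmx_cvg _ _ _ (nbhs z)).
- by move=> z' i j; exact: hmix.
- by move=> i j; exact: hmix.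
- by move=> i j; apply: pairmx_theta_cvg; exact: (kernel_c2 _ _ _ kx).
move=> i; rewrite [in X in _ --> X]mxE [X in _ + X]mxE.
under eq_fun do rewrite mxE [X in _ + X]mxE.
apply: cvgB; first exact: cvg_cst.
apply: (@lapmx_cvg _ _ _ (nbhs z)) => [k1 k2|k1]; last exact: cvg_cst.
by apply: pairmx_theta_cvg; exact: (kernel_c1 _ _ _ kx).
Qed.

Lemma theta_grad_x z m k : theta_grad z (lshift N m) k 0 = - (theta_res z *m theta_lap z) k m.
Proof.
rewrite /theta_grad delta_mx_lshift row_mxKl row_mxKr trmx0 sub0r mulmxN mulmxA trmx_delta.
by rewrite mxE -colE mxE.
Qed.

Lemma theta_grad_p z m k : theta_grad z (rshift N m) k 0 = theta_res z k m.
Proof.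
rewrite /theta_grad delta_mx_rshift row_mxKl row_mxKr trmx0 mulmx0 subr0 trmx_delta.
by rewrite -colE mxE.
Qed.

End Theta.

(** * Power sums of theta: regularity, commutation and independence *)

Lemma C1_is_derive {R : realType} {n : nat} (f : 'rV[R]_n -> R) (df : 'I_n -> 'rV[R]_n -> R) :
  (forall z k, is_derive z (delta_mx ord0 k) f (df k z)) ->
  (forall k, continuous (df k)) -> C1 f.
Proof.
move=> Hf cf; split=> [z k|k]; first exact: ex_derive.
by rewrite (_ : pd f k = df k) //; apply/funext => z; exact: derive_val.
Qed.

Lemma cvg_expr {R : realType} {S : Type} {F : set_system S} {FF : Filter F} (f : S -> R) (l : R) n :
  f s @[s --> F] --> l -> f s ^+ n @[s --> F] --> l ^+ n.
Proof.
move=> cf; elim: n => [|n IH]; first by under eq_fun do rewrite expr0; exact: cvg_cst.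
by under eq_fun do rewrite exprS; rewrite exprS; exact: cvgM.
Qed.

Lemma is_derive_power_sum {R : realType} {n N : nat} (th : 'I_N -> 'rV[R]_n -> R) a z k
    (dth : 'I_N -> R) : (forall i, is_derive z (delta_mx ord0 k) (th i) (dth i)) ->
  is_derive z (delta_mx ord0 k) (fun z => \sum_(i < N) th i z ^+ a)
    (\sum_(i < N) a%:R * th i z ^+ a.-1 * dth i).
Proof.
move=> H; rewrite (_ : (fun z => _) = \sum_(i < N) (th i ^+ a)).
  by apply: is_derive_sum => i; exact: is_deriveX.
by apply/funext => x; rewrite fct_sumE; apply: eq_bigr => i _; rewrite exprfctE.
Qed.

Section PowerSums.
Context {R : realType} (psi : R -> R -> R) {N : nat}.
Hypotheses (hC2 : C2 (psi2 psi)) (hmix : forall x th : R, 0 <= psixth psi x th)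
  (hsym : forall x th : R, psi (- x) (- th) = psi x th).
Implicit Types (z : 'rV[R]_(N + N)) (F G : 'rV[R]_(N + N) -> R) (A B : 'rV[R]_N).

Let X := @theta_res R psi N.
Let L := @theta_lap R psi N.

(** The chain rule for a function of theta: the row [A] stands for its derivative with respect to
    theta. *)
Definition has_theta_gradient F z A := forall k, pd F k z = (A *m theta_grad psi z k) 0 0.

Lemma theta_gradient_x F z A m : has_theta_gradient F z A ->
  pd F (lshift N m) z = - (A *m (X z *m L z)) 0 m.
Proof.
move=> ->; rewrite !mxE -sumrN; apply: eq_bigr => i _.
by rewrite theta_grad_x mulrN.
Qed.

Lemma theta_gradient_p F z A m : has_theta_gradient F z A ->
  pd F (rshift N m) z = (A *m X z) 0 m.
Proof. by move=> ->; rewrite !mxE; apply: eq_bigr => i _; rewrite theta_grad_p. Qed.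

(** The gradients are [- A X L] in [x] and [A X] in [p], so the bracket equals
    [A (X L^T X^T - X L X^T) B^T], which vanishes because L is symmetric. *)
Lemma theta_gradient_poisson F G z A B : has_theta_gradient F z A ->
  has_theta_gradient G z B -> poisson F G z = 0.
Proof.
move=> HF HG.
transitivity (((A *m X z) *m (B *m (X z *m L z))^T
  - (A *m (X z *m L z)) *m (B *m X z)^T) 0 0).
  rewrite [in RHS]mxE [in X in _ = X + _]mxE [in X in _ = _ + X]mxE [in X in _ = _ + X]mxE.
  rewrite -sumrB; apply: eq_bigr => m _.
  rewrite !(theta_gradient_x _ _ _ _ HF, theta_gradient_x _ _ _ _ HG).
  rewrite !(theta_gradient_p _ _ _ _ HF, theta_gradient_p _ _ _ _ HG).
  by rewrite [(_^T) m 0]mxE [(_^T) m 0]mxE; ring.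
rewrite !trmx_mul theta_lap_sym // !mulmxA subrr mxE //.
Qed.

Lemma Qpsi_is_derive a z k : is_derive z (delta_mx ord0 k) (Qpsi N psi a)
  (\sum_(i < N) a%:R * thetaf psi z i ^+ a.-1 * theta_grad psi z k i 0).
Proof.
apply: (is_derive_power_sum (fun i z => thetaf psi z i) a z k).
by move=> i; exact: theta_pd.
Qed.

Lemma Qpsi_theta_gradient a z :
  has_theta_gradient (Qpsi N psi a) z (\row_i (a%:R * thetaf psi z i ^+ a.-1)).
Proof.
move=> k; rewrite [LHS](@derive_val _ _ _ _ _ _ _ (Qpsi_is_derive a z k)) mxE.
by apply: eq_bigr => i _; rewrite mxE.
Qed.

Lemma Qpsi_C1 a : C1 (Qpsi N psi a).
Proof.
apply: (C1_is_derive _ (fun k z => _) (Qpsi_is_derive a)) => k z.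
apply: (@cvg_bigsum _ _ _ (nbhs z)) => i _; apply: cvgM; last exact: theta_grad_cvg.
apply: cvgM; first exact: cvg_cst.
by apply: (@cvg_expr _ _ (nbhs z)); exact: thetaf_cvg.
Qed.

Lemma Hpsi_is_derive z k : is_derive z (delta_mx ord0 k) (Hpsi N psi)
  (2^-1 * pd (Qpsi N psi 2) k z).
Proof. exact: (is_deriveZ (2^-1) (is_pd _ _ _ ((Qpsi_C1 2).1 z k))). Qed.

Lemma Hpsi_C1 : C1 (Hpsi N psi).
Proof.
apply: (C1_is_derive _ (fun k z => _) Hpsi_is_derive) => k z.
apply: (@cvgM _ _ (nbhs z)); first exact: cvg_cst.
exact: (Qpsi_C1 2).2.
Qed.

Lemma Hpsi_theta_gradient z : has_theta_gradient (Hpsi N psi) z (\row_i thetaf psi z i).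
Proof.
move=> k; rewrite [LHS](@derive_val _ _ _ _ _ _ _ (Hpsi_is_derive z k)) Qpsi_theta_gradient.
rewrite !mxE mulr_sumr; apply: eq_bigr => i _; rewrite !mxE expr1 mulrA mulrA.
by rewrite mulVf ?mul1r // pnatr_eq0.
Qed.

Lemma distinct_theta_open :
  open [set z | forall i j : 'I_N, i != j -> thetaf psi z i != thetaf psi z j].
Proof.
rewrite openE => z Hz; rewrite /interior /=.
apply: (@filter_forall _ _ _ (nbhs z)) => i; apply: (@filter_forall _ _ _ (nbhs z)) => j.
have [->|ij] := eqVneq i j; first by apply: nearW => z'; rewrite eqxx.
have : \forall z' \near z, thetaf psi z' i - thetaf psi z' j != 0.
  apply: (@cvgr_neq0 _ _ _ (nbhs z) _ _ (thetaf psi z i - thetaf psi z j)).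
    by apply: cvgB; exact: thetaf_cvg.
  by rewrite subr_eq0 Hz.
by apply: filterS => z'; rewrite subr_eq0.
Qed.

(** With [x] fixed, theta is moved to [theta_i + s * i] and [p] is recomputed from its equation. The
    new points tend to [z] as [s] tends to 0 and have distinct theta for small nonzero [s]. *)
Lemma distinct_theta_dense :
  dense [set z | forall i j : 'I_N, i != j -> thetaf psi z i != thetaf psi z j].
Proof.
move=> O [z Oz] oO.
pose th (s : R) (i : 'I_N) := thetaf psi z i + s * i%:R.
pose zs s := row_mx (\row_i xs z i) (\row_i Tmap (psix psi) (xs z) (th s) i).
have xsE s : xs (zs s) = xs z by apply/funext => i; rewrite /xs /zs row_mxEl mxE.
have thE s : thetaf psi (zs s) =1 th s.
  by apply: thetaf_unique => // i; rewrite xsE /ps /zs row_mxEr mxE.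
have cth i : th s i @[s --> 0^'] --> thetaf psi z i.
  have : th s i @[s --> 0^'] --> thetaf psi z i + 0 * i%:R.
    apply: cvgD; first exact: cvg_cst.
    by apply: cvgM; [move=> C; apply: cvg_within | exact: cvg_cst].
  by rewrite mul0r addr0.
have czs : zs s @[s --> 0^'] --> z.
  apply: cvg_rV => k; case: (split_ordP k) => i ->.
    under eq_fun => s do rewrite -/(xs (zs s) i) xsE.
    exact: cvg_cst.
  under eq_fun do rewrite row_mxEr mxE.
  rewrite -/(ps z i) -(thetafP psi hC2 hmix z i).
  by apply: (Tmap_cvg _ _ _ (psix_kernel psi hC2 hmix)) => // j; exact: cvg_cst.
have K1 : \forall s \near 0^', O (zs s) by apply: czs; exact: open_nbhs_nbhs.
have K2 : \forall s \near 0^', forall i j : 'I_N, i != j -> th s i != th s j.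
  apply: filter_forall => i; apply: filter_forall => j.
  have [->|ij] := eqVneq i j; first by apply: nearW => s; rewrite eqxx.
  (* Equal values are separated by every nonzero [s]; different values stay different for small
     [s]. *)
  have [tij|tij] := eqVneq (thetaf psi z i) (thetaf psi z j).
    near=> s; rewrite /th tij => _; rewrite (inj_eq (addrI _)) (inj_eq (mulfI _)) ?eqr_nat //.
    by near: s; exact: nbhs_dnbhs_neq.
  have : \forall s \near 0^', th s i - th s j != 0.
    apply: (@cvgr_neq0 _ _ _ _ _ _ (thetaf psi z i - thetaf psi z j)).
      by apply: cvgB.
    by rewrite subr_eq0.
  by apply: filterS => s; rewrite subr_eq0.
have K : \forall s \near (0 : R)^', O (zs s) /\ forall i j : 'I_N, i != j -> th s i != th s j.
  exact: filterI K1 K2.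
have [s Ks] := @filter_ex R _ (Proper_dnbhs_numFieldType _) _ K; have [Os Hs] := Ks.
by exists (zs s); split => // i j ij; rewrite !thE Hs.
Unshelve. all: by end_near.
Qed.

Lemma Qpsi_indep : funct_indep (fun k : 'I_N => Qpsi N psi k.+1).
Proof.
exists [set z | forall i j : 'I_N, i != j -> thetaf psi z i != thetaf psi z j].
split; first exact: distinct_theta_open.
split; first exact: distinct_theta_dense.
move=> z Hz; apply: inj_row_free => v Hv.
(* The derivative of the polynomial with coefficient [v_a] at degree [a + 1]. The default 0 of
   [oapp] only serves indices outside ['I_N], which [\poly_(a < N)] never reads. *)
pose p := \poly_(a < N) (oapp (fun b : 'I_N => v 0 b * b.+1%:R) 0 (insub a)).
have pE x : p.[x] = \sum_(a < N) v 0 a * a.+1%:R * x ^+ a.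
  by rewrite horner_poly; apply: eq_bigr => a _; rewrite valK.
(* The momentum columns of the relation say that the row of values [p(theta_i)] times X is zero, and
   X is invertible. *)
have p0 : \row_i p.[thetaf psi z i] = 0.
  apply: (can_inj (mulmxK (theta_res_unit psi hmix z))); rewrite mul0mx.
  apply/rowP => m; have := congr1 (fun w : 'rV[R]_(N + N) => w 0 (rshift N m)) Hv.
  rewrite !mxE => /(etrans _); apply.
  under eq_bigr => i _ do rewrite mxE pE mulr_suml.
  rewrite exchange_big /=; apply: eq_bigr => a _.
  rewrite mxE (theta_gradient_p _ _ _ _ (Qpsi_theta_gradient _ _)) mxE mulr_sumr.
  by apply: eq_bigr => i _; rewrite mxE /= !mulrA.
(* [N] distinct roots exceed the degree. *)
have {}p0 : p = 0.
  apply: (@roots_geq_poly_eq0 _ p [seq thetaf psi z i | i <- enum 'I_N]).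
  - apply/allP => _ /mapP [i _ ->]; apply/rootP.
    by have := congr1 (fun w : 'rV[R]_N => w 0 i) p0; rewrite !mxE.
  - rewrite map_inj_uniq ?enum_uniq // => i j E.
    by apply/eqP; apply: contraT => /Hz; rewrite E eqxx.
  - by rewrite size_map size_enum_ord size_poly.
apply/rowP => a; rewrite mxE; have := congr1 (fun q : {poly R} => q`_a) p0.
rewrite coef_poly ltn_ord valK /= coef0 => /eqP.
by rewrite mulf_eq0 pnatr_eq0 orbF => /eqP.
Qed.

Lemma Qpsi_LI : LI_with (Hpsi N psi) (Qpsi N psi).
Proof.
split.
- exact: Hpsi_C1.
- by move=> a _; exact: Qpsi_C1.
- exact: Qpsi_indep.
- by move=> a b _ _ z; exact: (theta_gradient_poisson _ _ _ _ _ (Qpsi_theta_gradient a z)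
    (Qpsi_theta_gradient b z)).
- by move=> a _ z; exact: (theta_gradient_poisson _ _ _ _ _ (Qpsi_theta_gradient a z)
    (Hpsi_theta_gradient z)).
Qed.

End PowerSums.

(** * The Hamiltonian flow of [Hpsi] *)

Section TmapDerivative.
Context {R : realType} (g ga gb : R -> R -> R) (hg : monotone_C1_kernel g ga gb) {N : nat}.

(** Gives the rate of change of [p] when [x] moves and theta is constant. *)
Lemma Tmap_derive1 (u : R -> 'I_N -> R) (u' : 'cV[R]_N) (v : 'I_N -> R) (t : R) :
  (forall i, is_derive t 1 (u^~ i) (u' i 0)) ->
  forall i, is_derive t 1 (fun s => Tmap g (u s) v i) ((lapmx (pairmx ga (u t) v) *m u') i 0).
Proof.
move=> Hu i; rewrite mul_lapmx /oplap big_mkcond /= -[X in is_derive _ _ _ X]add0r.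
rewrite (_ : (fun s => _) = cst (v i) + \sum_(j < N)
    (fun s => if j != i then g (u s i - u s j) (v i - v j) else 0)); last first.
  by apply/funext => s; rewrite /Tmap big_mkcond /= fctE fct_sumE.
apply: is_deriveD; apply: is_derive_sum => j.
case: (j != i); last exact: is_derive_cst.
exact: (@is_derive1_comp _ (g^~ (v i - v j)) (fun s => u s i - u s j) t _ _
  (kernel_d1 _ _ _ hg _ _) (is_deriveB (Hu i) (Hu j))).
Qed.

(** Gives the rate of change of [y] when [x] moves and theta is constant. *)
Lemma Tmap_derive2 (u : 'I_N -> R) (v : R -> 'I_N -> R) (v' : 'cV[R]_N) (t : R) :
  (forall i, is_derive t 1 (v^~ i) (v' i 0)) ->
  forall i, is_derive t 1 (fun s => Tmap g u (v s) i)
    (v' i 0 + oplap (pairmx gb u (v t)) (v'^~ 0) i).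
Proof.
move=> Hv i; rewrite /oplap big_mkcond /=.
rewrite (_ : (fun s => _) = v^~ i + \sum_(j < N)
    (fun s => if j != i then g (u i - u j) (v s i - v s j) else 0)); last first.
  by apply/funext => s; rewrite /Tmap big_mkcond /= fctE fct_sumE.
apply: is_deriveD; apply: is_derive_sum => j.
case: (j != i); last exact: is_derive_cst.
exact: (@is_derive1_comp _ (g (u i - u j)) (fun s => v s i - v s j) t _ _
  (kernel_d2 _ _ _ hg _ _) (is_deriveB (Hv i) (Hv j))).
Qed.

End TmapDerivative.

Lemma pd_coord {R : realType} {n : nat} (j k : 'I_n) (z : 'rV[R]_n) :
  pd (Defs.coord j) k z = (j == k)%:R.
Proof.
rewrite /pd; apply: derive_val; apply/is_pdP.
rewrite (_ : (fun s => _) = fun s => s * (j == k)%:R + z 0 j); first exact: is_derive_affine.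
by apply/funext => s; rewrite /Defs.coord !mxE eqxx.
Qed.

Lemma poisson_coord_x {R : realType} {N : nat} (F : 'rV[R]_(N + N) -> R) z m :
  poisson (Defs.coord (lshift N m)) F z = pd F (rshift N m) z.
Proof.
rewrite /poisson (bigD1 m) //= !pd_coord eqxx eq_lrshift mul1r mul0r subr0 big1 ?addr0 //.
by move=> i im; rewrite !pd_coord eq_lrshift eq_lshift eq_sym (negbTE im) !mul0r subr0.
Qed.

Lemma poisson_coord_p {R : realType} {N : nat} (F : 'rV[R]_(N + N) -> R) z m :
  poisson (Defs.coord (rshift N m)) F z = - pd F (lshift N m) z.
Proof.
rewrite /poisson (bigD1 m) //= !pd_coord eqxx eq_rlshift mul1r mul0r sub0r big1 ?addr0 //.
by move=> i im; rewrite !pd_coord eq_rlshift eq_rshift eq_sym (negbTE im) !mul0r subr0.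
Qed.

Section Flow.
Context {R : realType} (psi : R -> R -> R) {N : nat}.
Hypotheses (hC2 : C2 (psi2 psi)) (hmix : forall x th : R, 0 <= psixth psi x th)
  (hsym : forall x th : R, psi (- x) (- th) = psi x th).
Implicit Types (z : 'rV[R]_(N + N)) (y th : 'rV[R]_N).

Definition velocity z : 'cV[R]_N := theta_res psi z *m \col_i thetaf psi z i.

(** The [p]-gradient of [Hpsi] is the row [theta^T X]; as X is symmetric, its transpose is
    [X theta]. *)
Lemma ham_velocity z m : poisson (Defs.coord (lshift N m)) (Hpsi N psi) z = velocity z m 0.
Proof.
rewrite poisson_coord_x (theta_gradient_p _ _ _ _ _ (Hpsi_theta_gradient psi hC2 hmix z)).
transitivity ((velocity z)^T 0 m); last by rewrite mxE.
rewrite /velocity trmx_mul theta_res_sym //; congr ((_ *m _) _ _).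
by apply/rowP => i; rewrite !mxE.
Qed.

Lemma ham_force z m :
  poisson (Defs.coord (rshift N m)) (Hpsi N psi) z = (theta_lap psi z *m velocity z) m 0.
Proof.
rewrite poisson_coord_p (theta_gradient_x _ _ _ _ _ (Hpsi_theta_gradient psi hC2 hmix z)) opprK.
transitivity ((theta_lap psi z *m velocity z)^T 0 m); last by rewrite mxE.
rewrite /velocity !trmx_mul theta_res_sym // theta_lap_sym // mulmxA.
congr ((_ *m _ *m _) _ _).
by apply/rowP => i; rewrite !mxE.
Qed.

(** Hamilton's equations in coordinates, [x' = X theta] and [p' = L x'], the form to which the
    derivative formulas along curves apply. *)
Lemma ham_solutionP (gamma : R -> 'rV[R]_(N + N)) :
  ham_solution (Hpsi N psi) gamma <-> forall (t : R) i,
    is_derive t 1 (fun s => xs (gamma s) i) (velocity (gamma t) i 0) /\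
    is_derive t 1 (fun s => ps (gamma s) i) ((theta_lap psi (gamma t) *m velocity (gamma t)) i 0).
Proof.
split=> [H t i|H t].
  have [dg Hg] := H t; have dgk := (derivable_mxP _ _ _).1 dg ord0.
  split; split; try exact: dgk.
    by have := Hg (lshift N i); rewrite derive_mx // mxE ham_velocity.
  by have := Hg (rshift N i); rewrite derive_mx // mxE ham_force.
have dg : derivable gamma t 1.
  apply/derivable_mxP => o k; rewrite ord1.
  by case: (split_ordP k) => i ->; have [Hx Hp] := H t i; exact: ex_derive.
split=> // k; rewrite derive_mx // mxE.
case: (split_ordP k) => i ->; have [Hx Hp] := H t i.
  by rewrite ham_velocity; exact: derive_val.
by rewrite ham_force; exact: derive_val.
Qed.

Let kx := psix_kernel psi hC2 hmix.
Let ky := psith_kernel psi hC2 hmix.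

Lemma thetaf_traj y th t : thetaf psi (traj psi y th t) = th ord0.
Proof.
apply/funext; apply: thetaf_unique => // i.
by have := ps_omega psi (row_mx (y + t *: th) th) i; rewrite row_mxKr.
Qed.

Lemma Tmap_traj y th t :
  Tmap (fun b a => psith psi a b) (th ord0) (xs (traj psi y th t)) =1 (y + t *: th) ord0.
Proof. by move=> i; rewrite /traj xs_omega row_mxKl row_mxKr omega_xP. Qed.

(** Here theta is constant and [y' = theta], so implicit differentiation of the [y]-equation gives
    [x' = X theta]. Differentiating the [p]-equation at constant theta then gives [p' = L x']. *)
Lemma traj_ham_solution y th : ham_solution (Hpsi N psi) (traj psi y th).
Proof.
apply/ham_solutionP => t.
have Hx i : is_derive t 1 (fun s => xs (traj psi y th s) i) (velocity (traj psi y th t) i 0).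
  have := Tmap_solution_derive_mx _ _ _ (fun=> th ord0) (fun s => xs (traj psi y th s))
    (fun s => (y + s *: th) ord0) 0 th^T t ky (Tmap_traj y th).
  rewrite mulmx0 subr0 /velocity /theta_res thetaf_traj.
  rewrite (_ : \col_i _ = th^T); last by apply/colP => j; rewrite !mxE.
  apply=> j; first by rewrite mxE; exact: is_derive_cst.
  rewrite (_ : (fun s => _) = fun s => s * th^T j 0 + y 0 j); first exact: is_derive_affine.
  by apply/funext => s; rewrite !mxE addrC.
move=> i; split => //.
have := Tmap_derive1 _ _ _ kx (fun s => xs (traj psi y th s)) (velocity (traj psi y th t))
  (th ord0) t Hx i.
rewrite -{2}(thetaf_traj y th t); congr is_derive; apply/funext => s.
by rewrite -(thetaf_traj y th s) thetafP.
Qed.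

(** Along a solution [theta' = X (L x' - L x') = 0]. With theta constant,
    [y' = (1 + Laplacian) X theta = theta], so [y - t theta] is constant and the initial data
    determine the curve. *)
Lemma ham_solution_traj (gamma : R -> 'rV[R]_(N + N)) :
  ham_solution (Hpsi N psi) gamma -> exists y th : 'rV[R]_N, gamma = traj psi y th.
Proof.
move=> /ham_solutionP H.
have Hth t i : thetaf psi (gamma t) i = thetaf psi (gamma 0) i.
  apply: (@is_derive_0_is_cst _ (fun s => thetaf psi (gamma s) i)) => s.
  have := theta_derive_curve psi hC2 hmix gamma (velocity (gamma s))
    (theta_lap psi (gamma s) *m velocity (gamma s)) s (fun i => (H s i).1) (fun i => (H s i).2) i.
  by rewrite subrr mulmx0 mxE.
pose th : 'rV[R]_N := \row_i thetaf psi (gamma 0) i.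
have thE t : thetaf psi (gamma t) = th ord0 by apply/funext => i; rewrite mxE Hth.
pose Y t := Tmap (fun b a => psith psi a b) (th ord0) (xs (gamma t)).
have dY (t : R) i : is_derive t 1 (fun s : R => Y s i - s * th 0 i) 0.
  have dYt := Tmap_derive2 _ _ _ ky (th ord0) (fun s => xs (gamma s)) (velocity (gamma t)) t
    (fun i => (H t i).1) i.
  have E : velocity (gamma t) i 0 + oplap (pairmx (fun b a => psixth psi a b) (th ord0)
      (xs (gamma t))) ((velocity (gamma t))^~ 0) i = th 0 i.
    rewrite /velocity /theta_res thE; rewrite resmx_solution ?mxE ?thE //.
    by move=> k l; exact: hmix.
  rewrite E in dYt.
  have := is_deriveB dYt (is_derive_affine (th 0 i) 0 t); rewrite subrr.
  by congr is_derive; apply/funext => s; rewrite -[in RHS](addr0 (s * _)).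
exists (\row_i Y 0 i), th; apply/funext => t; apply/esym/omega_eq => // i; last first.
  by rewrite -(thE t) thetafP.
have := @is_derive_0_is_cst _ (fun s => Y s i - s * th 0 i) t 0 (dY^~ i).
rewrite mul0r subr0 => E; rewrite mxE [X in X + _]mxE [X in _ + X]mxE.
by rewrite -E subrK.
Qed.

End Flow.

(** * Clusters and the finite range of the quasi-potentials *)

Lemma psix_restrict {R : realType} (eps : R) (psi : R -> R -> R) {N : nat}
    (z : 'rV[R]_(N + N)) (I : {set 'I_N}) (th : 'I_N -> R) (k : 'I_#|I|) :
  (forall x th : R, eps <= `|x| -> psix psi x th = 0) ->
  (forall i j, i \in I -> j \notin I -> eps < `|xs z i - xs z j|) ->
  Tmap (psix psi) (xs (Defs.restrict z I)) (fun k => th (enum_val k)) k =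
  Tmap (psix psi) (xs z) th (enum_val k).
Proof.
move=> hrange Hsep; rewrite /Tmap; congr (_ + _).
have xsE l : xs (Defs.restrict z I) l = xs z (enum_val l) by rewrite /xs row_mxEl mxE.
(* Particles outside [I] are farther than [eps] away, where psi_x vanishes; the remaining sum is
   reindexed by the enumeration of [I]. *)
rewrite [RHS](bigID (mem I)) /= [X in _ = _ + X]big1 ?addr0 => [|j /andP [_ jI]]; last first.
  by apply: hrange; apply/ltW/Hsep => //; exact: enum_valP.
rewrite (eq_bigl (fun j => (j \in I) && (j != enum_val k))) => [|j]; last by rewrite andbC.
rewrite big_enum_val_cond /=.
by apply: eq_big => [l|l _]; rewrite ?(inj_eq enum_val_inj) // !xsE.
Qed.

(** A distance of at most [eps] would be an edge joining [j] to the component of [i]. *)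
Lemma Peps_separated {R : realType} (eps : R) {N : nat} (x : 'I_N -> R) (I : {set 'I_N}) i j :
  I \in Peps eps x -> i \in I -> j \notin I -> eps < `|x i - x j|.
Proof.
move=> /imsetP [k _ ->]; rewrite !inE /= => ki kj; rewrite ltNge; apply: contra kj => le.
by apply: connect_trans ki _; apply: connect1.
Qed.

Lemma Peps_partition {R : realType} (eps : R) {N : nat} (x : 'I_N -> R) :
  finset.partition (Peps eps x) [set: 'I_N].
Proof.
apply: equivalence_partitionP => i j k _ _ _; split; first exact: connect0.
move=> cij; apply: same_connect cij _; apply: sym_connect_sym => {}i {}j.
by rewrite /cluster_rel distrC.
Qed.

Section FiniteRange.
Context {R : realType} (eps : R) (psi : R -> R -> R).
Hypotheses (hC2 : C2 (psi2 psi)) (hmix : forall x th : R, 0 <= psixth psi x th)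
  (hsym : forall x th : R, psi (- x) (- th) = psi x th)
  (hrange : forall x th : R, eps <= `|x| -> psix psi x th = 0).

(** The thetas of the full system with index in [I] solve the [p]-equation of the isolated cluster,
    so they are its thetas by uniqueness. *)
Lemma thetaf_restrict {N : nat} (z : 'rV[R]_(N + N)) I : I \in Peps eps (xs z) ->
  forall k, thetaf psi (Defs.restrict z I) k = thetaf psi z (enum_val k).
Proof.
move=> HI; apply: thetaf_unique => // k.
rewrite (psix_restrict eps) //; last by move=> i j; exact: Peps_separated.
by rewrite thetafP // /ps row_mxEr mxE.
Qed.

Definition quasi_potential a N (z : 'rV[R]_(N + N)) := Qpsi N psi a z - \sum_(i < N) ps z i ^+ a.

Lemma sum_ps_is_derive N a (z : 'rV[R]_(N + N)) k :
  is_derive z (delta_mx ord0 k) (fun z => \sum_(i < N) ps z i ^+ a)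
    (\sum_(i < N) a%:R * ps z i ^+ a.-1 * (rshift N i == k)%:R).
Proof.
apply: (is_derive_power_sum (fun i z => ps z i)) => i.
apply/is_pdP; rewrite (_ : (fun s => _) = fun s => s * (rshift N i == k)%:R + ps z i).
  exact: is_derive_affine.
by apply/funext => s; rewrite /ps !mxE eqxx.
Qed.

Lemma quasi_potential_C1 a N : C1 (@quasi_potential a N).
Proof.
have HQ z k := is_pd _ _ _ ((@Qpsi_C1 _ psi N hC2 hmix a).1 z k).
apply: (C1_is_derive _ (fun k z => _) (fun z k => is_deriveB (HQ z k) (sum_ps_is_derive N a z k))).
move=> k z; apply: (@cvgB _ _ _ (nbhs z)); first exact: (Qpsi_C1 _ _ _ _).2.
apply: (@cvg_bigsum _ _ _ (nbhs z)) => i _; apply: cvgM; last exact: cvg_cst.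
apply: cvgM; first exact: cvg_cst.
by apply: (@cvg_expr _ _ (nbhs z)); exact: coord_continuous.
Qed.

(** A single particle has no interaction sum, so its theta is its momentum. *)
Lemma quasi_potential1 a z : @quasi_potential a 1 z = 0.
Proof.
rewrite /quasi_potential /Qpsi !big_ord1.
rewrite -(thetafP psi hC2 hmix z ord0) /Tmap big_pred0 ?addr0 ?subrr //.
by move=> j; rewrite ord1.
Qed.

Lemma sum_blocks {N : nat} (P : {set {set 'I_N}}) (F : 'I_N -> R) :
  finset.partition P [set: 'I_N] ->
  \sum_(I in P) \sum_(k < #|I|) F (enum_val k) = \sum_(i < N) F i.
Proof.
move=> /and3P [/eqP cP tP _].
under eq_bigr => I _ do rewrite -(big_enum_val F).
by rewrite -finset.big_trivIset //= cP; apply: eq_bigl => i; rewrite inE.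
Qed.

(** The quasi-potential of [n] particles is itself the cluster function, a choice independent of
    [N]. Both power sums split over the blocks, and theta restricts to each block. *)
Lemma quasi_potential_finite_range a : finite_range_unif eps a (fun N => @quasi_potential a N).
Proof.
split; first by move=> N _ _; exact: quasi_potential_C1.
exists (fun n => @quasi_potential a n); split; first by move=> n _; exact: quasi_potential_C1.
split; first exact: quasi_potential1.
move=> N _ _ z; rewrite sumrB; congr (_ - _).
  rewrite /Qpsi -(sum_blocks (Peps eps (xs z))); last exact: Peps_partition.
  by apply: eq_bigr => I HI; apply: eq_bigr => k _; rewrite thetaf_restrict.
rewrite -(sum_blocks (Peps eps (xs z))); last exact: Peps_partition.
by apply: eq_bigr => I HI; apply: eq_bigr => k _; rewrite /ps row_mxEr mxE.
Qed.

End FiniteRange.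

(* The sums of powers of the momenta are the conserved quantities of psi = 0. *)
Lemma power_sums_indep {R : realType} (N : nat) :
  funct_indep (fun (k : 'I_N) (z : 'rV[R]_(N + N)) => \sum_(i < N) ps z i ^+ k.+1).
Proof.
pose psi0 : R -> R -> R := fun _ _ => 0.
have pd_cst n (c : R) k : pd (fun=> c : R) k = (fun=> 0) :> ('rV[R]_n -> R).
  by apply/funext => z; rewrite /pd; apply: derive_val; exact: is_derive_cst.
have cstC1 n (c : R) : C1 ((fun=> c) : 'rV[R]_n -> R).
  exact: (C1_is_derive _ (fun _ => fun=> 0) (fun z k => is_derive_cst c z _)
    (fun _ => @cst_continuous _ _ 0)).
have hC2 : C2 (psi2 psi0).
  by split; [exact: cstC1 | move=> k; rewrite pd_cst; exact: cstC1].
have psix0 a b : psix psi0 a b = 0 by rewrite /psix pd_cst.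
have hmix (a b : R) : 0 <= psixth psi0 a b by rewrite /psixth !pd_cst.
have thE (z : 'rV[R]_(N + N)) : thetaf psi0 z =1 ps z.
  by apply: thetaf_unique => // i; rewrite /Tmap big1 ?addr0.
have := @Qpsi_indep _ psi0 N hC2 hmix.
rewrite (_ : (fun k : 'I_N => _) = fun k z => \sum_(i < N) ps z i ^+ k.+1) //.
by apply/funext => k; apply/funext => z; apply: eq_bigr => i _; rewrite thE.
Qed.

(** * Regularity of the dispersion relations and assembly of all the claims *)

Lemma C1R_expr {R : realType} a : C1R (fun p : R => p ^+ a).
Proof.
have D (x : R) : is_derive x 1 (fun p : R => p ^+ a) (a%:R * x ^+ a.-1).
  rewrite (_ : (fun p => _) = (id : R -> R) ^+ a); last by apply/funext => p; rewrite exprfctE.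
  rewrite -[_ * _]mulr1; exact: (is_deriveX a (is_derive_id x (1 : R))).
split=> [x|]; first exact: ex_derive.
rewrite (_ : (fun x => _) = fun x => a%:R * x ^+ a.-1); last first.
  by apply/funext => x; exact: derive_val.
move=> x; apply: (@cvgM _ _ (nbhs x)); first exact: cvg_cst.
by apply: (@cvg_expr _ _ (nbhs x)); exact: cvg_id.
Qed.

Theorem theorem1 (R : realType) (eps : R) (psi : R -> R -> R)
  (heps : 0 < eps)
  (hC2 : C2 (psi2 psi))
  (hmix : forall x th : R, 0 <= psixth psi x th)
  (hsym : forall x th : R, psi (- x) (- th) = psi x th)
  (hrange : forall x th : R, eps <= `|x| -> psix psi x th = 0) :
  (forall N : nat, (1 <= N)%N ->
    [/\ C1 (Hpsi N psi),
        (forall y th : 'rV[R]_N, ham_solution (Hpsi N psi) (traj psi y th)) /\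
        (forall gamma : R -> 'rV[R]_(N + N), ham_solution (Hpsi N psi) gamma ->
           exists y th : 'rV[R]_N, gamma = traj psi y th),
        LI_with (Hpsi N psi) (Qpsi N psi),
        (forall z, Hpsi N psi z = 2^-1 * Qpsi N psi 2 z)
      & Liouville_integrable (Hpsi N psi)]) /\
  LIFR_wrt eps (fun N => Hpsi N psi) (fun (a : nat) (p : R) => p ^+ a)
    (fun N => Qpsi N psi) /\
  LIFR eps (fun N => Hpsi N psi).
Proof.
have LIFRQ : LIFR_wrt eps (fun N => Hpsi N psi) (fun (a : nat) (p : R) => p ^+ a)
    (fun N => Qpsi N psi).
  split.
  - by move=> N _; exact: Qpsi_LI.
  - by move=> a _; exact: C1R_expr.
  - by move=> N _; exact: power_sums_indep.
  - by move=> a _; exact: quasi_potential_finite_range.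
split; last by split=> //; do 2 eexists; exact: LIFRQ.
move=> N _; split.
- exact: Hpsi_C1.
- split; first by move=> y th; exact: traj_ham_solution.
  by move=> gamma; exact: ham_solution_traj.
- exact: Qpsi_LI.
- by [].
- by exists (Qpsi N psi); exact: Qpsi_LI.
Qed.
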